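(* There exist universal constants $C_1,C_2,C_5,C_6>0$ such that the following holds for the model $\mathcal A(\delta,\epsilon,\sigma)$ defined in the context, for all $\delta\ge0$, $\sigma>0$ and positive integers $n,m,d,K$. Assume $0\le\epsilon\le\frac12$, $1\le K\le d/C_1$ and $\frac{\sigma+1}{\sigma^2}\frac dn\le C_2$. Then $$\inf_{\{\hat V_i\}_{i=1}^m}\ \sup_{\mathbb P\in\mathcal A(\delta,\epsilon,\sigma)}\mathbb P\Bigg(\frac1m\sum_{i=1}^m\|\hat V_i\hat V_i^T-V_iV_i^T\|_F^2\ge C_5\bigg(\frac{(\sigma+1)Kd}{\sigma^2nm}+\delta^2\wedge\frac{(\sigma+1)Kd}{\sigma^2n}+\frac{(\sigma+1)\epsilon Kd}{\sigma^2n}\bigg)\Bigg)\ge C_6,$$ where the infimum is over all collections of estimators $\hat V_i=\hat V_i(X_1,\dots,X_m)\in\mathbb R^{d\times K}$ with orthonormal columns, measurable in the data.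
   Context: Observe $X_1,\dots,X_m$ with $X_i\in\mathbb R^{n\times d}$. For $\delta\ge0$, $0\le\epsilon\le1$, $\sigma>0$, the model $\mathcal A(\delta,\epsilon,\sigma)$ is the set of all joint distributions $\mathbb P$ of $(X_1,\dots,X_m)$ for which there is a subset $\mathcal S\subseteq[m]=\{1,\dots,m\}$ with $|\mathcal S^c|\le\epsilon m$ such that: (1) the $X_i$, $i\in\mathcal S$, are independent and, for each $i\in\mathcal S$, the rows of $X_i$ are i.i.d. from $\mathcal N(0,\Sigma_i)$ with $\Sigma_i=\sigma V_iV_i^T+I_d$, where $V_i\in\mathbb R^{d\times K}$ has orthonormal columns; moreover $\max_{i,j\in\mathcal S}\|V_iV_i^T-V_jV_j^T\|_F\le\delta$; (2) $\{X_i\}_{i\in\mathcal S^c}$ is independent of $\{X_i\}_{i\in\mathcal S}$, the $X_i$, $i\in\mathcal S^c$, are independent, and for each $i\in\mathcal S^c$ the rows of $X_i$ are i.i.d. from $\mathcal N(0,\Sigma_i)$ with $\Sigma_i=\sigma V_iV_i^T+I_d$, where $V_i\in\mathbb R^{d\times K}$ has orthonormal columns (with no closeness restriction). Here $\|\cdot\|_F$ is the Frobenius norm and $a\wedge b=\min(a,b)$. *)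

(* Defs.v *)
From HB Require Import structures.
From mathcomp Require Import all_boot all_order all_algebra.
From mathcomp Require Import all_classical all_reals all_analysis.

Set Implicit Arguments.
Unset Strict Implicit.
Unset Printing Implicit Defensive.

Import Order.TTheory GRing.Theory Num.Theory.
Import numFieldNormedType.Exports.

Local Open Scope classical_set_scope.
Local Open Scope ring_scope.

Definition measure_matrix_display : measure_display -> measure_display.
Proof. exact. Qed.

(* Matrices carry the product sigma-algebra, i.e. the one generated by the
   entries; over R this is the Borel sigma-algebra of R^(p * q). *)
Section measurable_matrix.
Context {d} {T : measurableType d}.
Variables p q : nat.

Definition matrix_cylinder : set (set 'M[T]_(p, q)) :=
  [set C | exists i j, exists2 B : set T,
    measurable B & C = [set M : 'M[T]_(p, q) | B (M i j)]].

Let matrix_set0 : <<s matrix_cylinder >> set0.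
Proof. exact: sigma_algebra0. Qed.

Let matrix_setC A : <<s matrix_cylinder >> A -> <<s matrix_cylinder >> (~` A).
Proof. exact: sigma_algebraC. Qed.

Let matrix_bigcup (F : _^nat) : (forall i, <<s matrix_cylinder >> (F i)) ->
  <<s matrix_cylinder >> (\bigcup_i (F i)).
Proof. exact: sigma_algebra_bigcup. Qed.

HB.instance Definition _ := @isMeasurable.Build (measure_matrix_display d)
  'M[T]_(p, q) <<s matrix_cylinder >> matrix_set0 matrix_setC matrix_bigcup.

End measurable_matrix.

Section independence.
Context {d d'} {Omega : measurableType d} {T : measurableType d'}.
Context {R : realType} {I : finType}.
Implicit Types (P : probability Omega R) (J : {set I}) (X : I -> Omega -> T).

(* Taking [B i = setT] for some of the indices yields the product rule for
   every subfamily. *)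
Definition mutually_independent P J X : Prop :=
  forall B : I -> set T, (forall i, measurable (B i)) ->
    P [set w | forall i, i \in J -> B i (X i w)] =
    (\prod_(i in J) P (X i @^-1` B i))%E.

Definition sigma_generated J X : set (set Omega) :=
  <<s [set A | exists2 i, i \in J &
         exists2 B : set T, measurable B & A = X i @^-1` B] >>.

Definition independent_families P J J' X : Prop :=
  forall A A', sigma_generated J X A -> sigma_generated J' X A' ->
    P (A `&` A') = (P A * P A')%E.

End independence.

Section gaussian.
Context {R : realType}.

(* [nu] is the law of a random row vector with i.i.d. N(0, 1) entries. *)
Definition standard_gaussian d (nu : set 'rV[R]_d -> \bar R) : Prop :=
  forall B : 'I_d -> set R, (forall j, measurable (B j)) ->
    nu [set z | forall j, B j (z ord0 j)] =
    (\prod_(j < d) normal_prob 0 1 (B j))%E.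

(* [mu] is N(0, Sigma), i.e. the law of [A z] with [A A^T = Sigma] and [z]
   standard Gaussian; vectors are rows, so [A z] is written [z *m A^T]. *)
Definition centered_gaussian d (Sigma : 'M[R]_d)
    (mu : set 'rV[R]_d -> \bar R) : Prop :=
  exists (A : 'M[R]_d) (nu : probability 'rV[R]_d R),
    [/\ A *m A^T = Sigma,
        standard_gaussian nu &
        forall B : set 'rV[R]_d, measurable B ->
          mu B = nu [set z | B (z *m A^T)]].

End gaussian.

Section model.
Context {R : realType}.

Definition frobenius_norm p q (A : 'M[R]_(p, q)) : R :=
  Num.sqrt (\sum_(i < p) \sum_(j < q) A i j ^+ 2).

Definition orthonormal_columns d K (V : 'M[R]_(d, K)) : Prop :=
  V^T *m V = 1%:M.

Variables m n d K : nat.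

Definition data := m.-tuple 'M[R]_(n, d).

Definition obs (i : 'I_m) (X : data) : 'M[R]_(n, d) := tnth X i.

Definition rows_iid_gaussian (P : probability data R) (i : 'I_m)
    (Sigma : 'M[R]_d) : Prop :=
  mutually_independent P [set: 'I_n]%SET (fun j X => row j (obs i X)) /\
  forall j : 'I_n,
    centered_gaussian Sigma (pushforward P (fun X => row j (obs i X))).

Definition spiked_cov (sigma : R) (V : 'M[R]_(d, K)) : 'M[R]_d :=
  sigma *: (V *m V^T) + 1%:M.

(* The joint law [P] belongs to A(delta, epsilon, sigma), with [V i] the
   matrix V_i appearing in the covariance of X_i. *)
Definition in_model (delta epsilon sigma : R) (P : probability data R)
    (V : 'I_m -> 'M[R]_(d, K)) : Prop :=
  (forall i, orthonormal_columns (V i)) /\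
  exists S : {set 'I_m},
    [/\ #|~: S|%:R <= epsilon * m%:R,
        [/\ mutually_independent P S obs,
            forall i, i \in S ->
              rows_iid_gaussian P i (spiked_cov sigma (V i)) &
            forall i j, i \in S -> j \in S ->
              frobenius_norm (V i *m (V i)^T - V j *m (V j)^T) <= delta] &
        [/\ independent_families P (~: S) S obs,
            mutually_independent P (~: S) obs &
            forall i, i \in ~: S ->
              rows_iid_gaussian P i (spiked_cov sigma (V i))]].

(* For n >= 1 and sigma > 0 the projections V_i V_i^T are determined by the
   joint law, so a supremum over the pairs below of a quantity depending on
   [V] only through these projections is a supremum over the joint laws. *)
Definition model (delta epsilon sigma : R) :
    set (probability data R * ('I_m -> 'M[R]_(d, K))) :=
  [set PV | in_model delta epsilon sigma PV.1 PV.2].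

Definition estimators : set ('I_m -> data -> 'M[R]_(d, K)) :=
  [set Vhat | forall i, measurable_fun setT (Vhat i) /\
                        forall X, orthonormal_columns (Vhat i X)].

Definition average_loss (Vhat V : 'I_m -> 'M[R]_(d, K)) : R :=
  m%:R^-1 * \sum_(i < m)
    frobenius_norm (Vhat i *m (Vhat i)^T - V i *m (V i)^T) ^+ 2.

End model.
Arguments data R m n d : clear implicits.
Arguments model {R} m n d K delta epsilon sigma.
Arguments estimators R m n d K : clear implicits.

(* Main.v *)
Require Import Defs.
From HB Require Import structures.
From mathcomp Require Import all_boot all_order all_algebra ring lra.
From mathcomp Require Import all_classical all_reals all_analysis measurable_realfun.

(** A d x K frame V is parametrized by the graph of a (d-K) x K matrix W with
    entries +-t: V V^T is the projector P(W) onto the column space of (1; W).  Flipping one entry of W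
    moves the corresponding entry of the off-diagonal block W (1 + W^T W)^-1 of
    P(W) by at least t, whatever the signs are, while
    |P(W) - P(W')|_F^2 <= 2 |W - W'|_F^2 for all W and W'.  Since the covariances
    have the same determinant, the Kullback-Leibler divergence of N(0, Sigma)
    and N(0, Sigma') is a multiple of sigma^2 / (sigma + 1) |P - P'|_F^2; so for
    t^2 ~ (sigma + 1) / (sigma^2 n) (divided by m if all the V_i are equal) no
    flip can be detected, and Assouad's argument makes a positive fraction of
    the (d-K) K entries of each W_i wrong by t/2 with positive probability.
    The three terms of the rate come from one matrix W shared by all samples,
    from independent W_i with entries small enough for delta, and from
    independent W_i for the corrupted samples only. *)

(** An estimator need not be a graph, so it is compared with the truth only on the lower-left [p] by
    [K] block of its projector, with [p = d - K]: there the squared Frobenius norm splits into one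
    term per bit. The obstacle is that neighbours in the cube must be separated on their own entry
    for every choice of the other signs, including those for which W has a large operator norm. An
    exact formula for the change of one entry solves this, since its terms are controlled by single
    rows and columns of W. Their squared norms are at most [d t^2], which [C2 = 1/8] keeps below
    1/8, and [C1 = 2] gives [K <= p], so that the block has at least half of [d K] entries.
    Undetectability is drawn from the mean of the log-likelihood ratio by Markov's inequality, so
    second moments of Gaussian rows suffice there. The number of missed entries is bounded, so a
    lower bound on its mean becomes one on a probability. Densities are stated as identities between
    integrals of nonnegative functions, a form that Tonelli's theorem multiplies over rows and
    samples. *)

Set Implicit Arguments.
Unset Strict Implicit.
Unset Printing Implicit Defensive.
Import Order.TTheory GRing.Theory Num.Theory.
Import numFieldNormedType.Exports.
Local Open Scope classical_set_scope.
Local Open Scope ring_scope.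

(** * Graph projectors *)

Section quadratic_forms.
Context {R : rcfType}.

Lemma mxtrace_mul_trE p q (A B : 'M[R]_(p, q)) :
  \tr (A *m B^T) = \sum_i \sum_j A i j * B i j.
Proof.
by apply: eq_bigr => i _; rewrite mxE; apply: eq_bigr => j _; rewrite mxE.
Qed.

Lemma mxtrace_gram_ge0 p q (A : 'M[R]_(p, q)) : 0 <= \tr (A *m A^T).
Proof.
rewrite mxtrace_mul_trE; apply: sumr_ge0 => i _; apply: sumr_ge0 => j _.
by rewrite -expr2 sqr_ge0.
Qed.

Lemma mxtrace_gram_gt0 p q (A : 'M[R]_(p, q)) : A != 0 -> 0 < \tr (A *m A^T).
Proof.
move=> A0; rewrite lt_neqAle mxtrace_gram_ge0 andbT eq_sym.
apply: contra A0; rewrite mxtrace_mul_trE psumr_eq0 => [/allP h|i _]; last first.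
  by apply: sumr_ge0 => j _; rewrite -expr2 sqr_ge0.
apply/eqP/matrixP => i j; rewrite mxE.
have := h i (mem_index_enum _); rewrite psumr_eq0 => [/allP/(_ j)|k _].
  by rewrite mem_index_enum -expr2 sqrf_eq0 => /(_ isT)/eqP.
by rewrite -expr2 sqr_ge0.
Qed.

Lemma mxtraceB n (A B : 'M[R]_n) : \tr (A - B) = \tr A - \tr B.
Proof. exact: linearB. Qed.

(** The value of the form is the trace of a 1 by 1 matrix, so that the same trace lemmas serve row
    vectors and matrices. *)
Definition posdef n (S : 'M[R]_n) :=
  forall x : 'rV[R]_n, x != 0 -> 0 < \tr (x *m S *m x^T).

(** Induction on the size: the Schur complement of the first diagonal entry is again symmetric and
    positive definite. The triangular shape with positive diagonal later allows a Gaussian change of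
    variables one coordinate at a time. *)
Lemma cholesky n (S : 'M[R]_n) : S^T = S -> posdef S ->
  exists A : 'M[R]_n, [/\ is_trig_mx A, forall i, 0 < A i i & A *m A^T = S].
Proof.
elim: n S => [|n IH] S symS pdS.
  exists 0; split; [exact: mx0_is_trig|by case|].
  by rewrite [RHS]flatmx0 [LHS]flatmx0.
pose S' : 'M[R]_(1 + n) := S.
pose a : R := S' 0 0; pose c : 'cV[R]_n := dlsubmx S'; pose D := drsubmx S'.
have ulE : ulsubmx S' = a%:M.
  by rewrite [LHS]mx11_scalar !mxE /a; congr (S' _ _)%:M; exact: val_inj.
have SE : S' = block_mx a%:M c^T c D.
  rewrite -[LHS]submxK ulE; congr (block_mx _ _ _ _).
  by rewrite /c trmx_dlsub (symS : S'^T = S').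
have pdS' : forall x : 'rV[R]_(1 + n), x != 0 -> 0 < \tr (x *m S' *m x^T) by exact: pdS.
have symD : D^T = D by rewrite /D trmx_drsub (symS : S'^T = S').
have a0 : 0 < a.
  have /pdS' : row_mx 1%:M 0 != 0 :> 'rV[R]_(1 + n).
    by rewrite row_mx_eq0 oner_eq0.
  rewrite SE (mul_row_block 1%:M 0 a%:M) tr_row_mx mul_row_col trmx1 trmx0.
  by rewrite mulmx0 mulmx1 mul1mx mul0mx !addr0 mxtrace_scalar.
have a_neq0 : a != 0 by rewrite gt_eqF.
have [] := IH (D - a^-1 *: (c *m c^T)).
- by rewrite linearB /= linearZ /= trmx_mul trmxK symD.
- move=> y y0.
  (* This first coordinate minimizes the form of [S'] for given [y]; the minimum is the form of the
     Schur complement at [y]. *)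
  have /pdS' : row_mx (- a^-1 *: (y *m c)) y != 0 :> 'rV[R]_(1 + n).
    by rewrite row_mx_eq0 negb_and y0 orbT.
  rewrite SE (mul_row_block _ _ a%:M) tr_row_mx mul_row_col.
  rewrite mul_mx_scalar scalerA mulrN divff// scaleN1r addNr mul0mx add0r.
  rewrite mulmxBr mulmxBl mulmxDl -!scalemxAr -!scalemxAl scaleNr addrC.
  by rewrite !mulmxA.
move=> A' [tA' dA' A'E].
pose r := Num.sqrt a.
have r_gt0 : 0 < r by rewrite sqrtr_gt0.
have r0 : r != 0 by rewrite gt_eqF.
pose B : 'M[R]_(1 + n) := block_mx r%:M 0 (r^-1 *: c) A'.
have tB : is_trig_mx B by rewrite is_trig_block_mx// eqxx tA' scalar_mx_is_trig.
have dB i : 0 < B i i.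
  case: (split_ordP i) => j ->; first by rewrite block_mxEul !mxE eqxx mulr1n.
  by rewrite block_mxEdr.
exists B; split => //; suff : B *m B^T = S' by [].
rewrite SE tr_block_mx mulmx_block !trmx0 tr_scalar_mx !mul0mx !addr0.
rewrite !mulmx0 !addr0 A'E linearZ /= -scalemxAr -scalemxAl -scalar_mxM -expr2.
rewrite sqr_sqrtr ?ltW// mul_mx_scalar mul_scalar_mx !scalerA mulVf//.
rewrite !scale1r -scalemxAl -scalemxAr scalerA -invfM -expr2 sqr_sqrtr ?ltW//.
by rewrite addrC subrK.
Qed.

End quadratic_forms.

(** * Orthogonal projectors onto graphs of matrices *)

Section graph_projector.
Context {R : rcfType}.
Variables K p : nat.
Implicit Types (W : 'M[R]_(p, K)).

Lemma mulmx_delta_mxE m n q r (A : 'M[R]_(m, n)) (B : 'M[R]_(q, r)) (x : R) i j k l :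
  (A *m (x *: delta_mx i j) *m B) k l = x * A k i * B j l.
Proof.
rewrite -scalemxAr -scalemxAl mxE -mulrA; congr (_ * _).
rewrite mxE (bigD1 j)//= big1 ?addr0 => [|j' j'j]; rewrite mxE (bigD1 i)//= big1.
- by rewrite mxE !eqxx mulr1 addr0.
- by move=> i' i'i; rewrite mxE (negbTE i'i) mulr0.
- by rewrite mxE eqxx (negbTE j'j) mulr0 addr0 mul0r.
- by move=> i' i'i; rewrite mxE (negbTE i'i) mulr0.
Qed.

Lemma mulmx_tr_diagE m n (A B : 'M[R]_(m, n)) k :
  (A *m B^T) k k = \tr (row k A *m (row k B)^T).
Proof.
by rewrite trace_mx11 !mxE; apply: eq_bigr => j _; rewrite !mxE.
Qed.

Definition graph_gram W : 'M[R]_K := 1%:M + W^T *m W.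

Local Notation G := graph_gram.
Local Notation N := (fun W => invmx (graph_gram W)).

Lemma graph_gram_sym W : (G W)^T = G W.
Proof. by rewrite linearD /= trmx1 trmx_mul trmxK. Qed.

Lemma graph_gram_posdef W : posdef (G W).
Proof.
move=> x x0; rewrite mulmxDr mulmx1 mulmxDl mxtraceD ltr_wpDr//.
  have -> : x *m (W^T *m W) *m x^T = x *m W^T *m (x *m W^T)^T.
    by rewrite trmx_mul trmxK !mulmxA.
  exact: mxtrace_gram_ge0.
exact: mxtrace_gram_gt0.
Qed.

(** Writing the inverse as a Gram matrix turns its quadratic forms into sums of squares. *)
Lemma graph_gram_factor W : exists A : 'M[R]_K,
  [/\ A \in unitmx, A *m A^T = G W & invmx (G W) = (invmx A)^T *m invmx A].
Proof.
have [A [tA _ AE]] := cholesky (graph_gram_sym W) (@graph_gram_posdef W).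
have uA : A \in unitmx.
  rewrite unitmxE unitfE; apply/negP => /eqP dA.
  have /det0P[x x0 xA] : \det A == 0 by apply/eqP.
  have := @graph_gram_posdef W x x0.
  by rewrite -AE mulmxA xA !mul0mx mxtrace0 ltxx.
exists A; split => //; rewrite -AE.
have uAT : A^T \in unitmx by rewrite unitmx_tr.
have uM : A *m A^T \in unitmx by rewrite unitmx_mul uA.
apply: (can_inj (mulmxK uM)).
by rewrite mulVmx// mulmxA mulmxKV// trmx_inv mulVmx.
Qed.

Lemma graph_gram_unit W : G W \in unitmx.
Proof.
have [A [uA <- _]] := graph_gram_factor W.
by rewrite unitmx_mul uA unitmx_tr.
Qed.

Lemma graph_gram_inv_sym W : (invmx (G W))^T = invmx (G W).
Proof. by rewrite trmx_inv graph_gram_sym. Qed.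

Definition graph_mx W : 'M[R]_(K + p, K) := col_mx 1%:M W.

(** Since [G W = M^T M] for [M = graph_mx W], this is the usual projector formula M (M^T M)^-1
    M^T. *)
Definition graph_proj W : 'M[R]_(K + p) :=
  graph_mx W *m invmx (G W) *m (graph_mx W)^T.

Lemma graph_mx_gram W W' : (graph_mx W)^T *m graph_mx W' = 1%:M + W^T *m W'.
Proof. by rewrite tr_col_mx mul_row_col trmx1 mulmx1. Qed.

Lemma graph_frame W : exists2 V : 'M[R]_(K + p, K),
  V^T *m V = 1%:M & V *m V^T = graph_proj W.
Proof.
have [A [uA AE NE]] := graph_gram_factor W.
exists (graph_mx W *m (invmx A)^T).
  rewrite trmx_mul trmxK mulmxA -[_ *m _ *m graph_mx W]mulmxA graph_mx_gram.
  by rewrite -/(G W) -AE mulmxA mulVmx// mul1mx trmx_inv mulmxV// unitmx_tr.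
by rewrite /graph_proj NE trmx_mul trmxK !mulmxA.
Qed.

Lemma graph_proj_sym W : (graph_proj W)^T = graph_proj W.
Proof. by rewrite /graph_proj !trmx_mul trmxK graph_gram_inv_sym mulmxA. Qed.

Lemma graph_proj_mul W : graph_proj W *m graph_mx W = graph_mx W.
Proof.
by rewrite /graph_proj -mulmxA graph_mx_gram mulmxKV// graph_gram_unit.
Qed.

Lemma graph_proj_idem W : graph_proj W *m graph_proj W = graph_proj W.
Proof. by rewrite {2 3}/graph_proj !mulmxA graph_proj_mul. Qed.

Lemma mxtrace_graph_proj W : \tr (graph_proj W) = K%:R.
Proof.
rewrite /graph_proj mxtrace_mulC mulmxA graph_mx_gram mulmxV ?graph_gram_unit//.
by rewrite mxtrace1.
Qed.

(** With S = W^T W and D = U (1 + S), this is the identity (1 + S)^2 = (1 + S) + S + S^2. It makes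
    the inequality [invmx (G W) <= 1] visible without any spectral theory. *)
Lemma mxtrace_gram_graph_inv q W (D : 'M[R]_(q, K)) (U := D *m invmx (G W)) :
  \tr (D *m D^T) = \tr (D *m invmx (G W) *m D^T)
    + \tr (U *m W^T *m (U *m W^T)^T) + \tr (U *m W^T *m W *m (U *m W^T *m W)^T).
Proof.
have DE : D = U *m G W by rewrite /U mulmxKV// graph_gram_unit.
have DTE : D^T = G W *m U^T by rewrite {1}DE trmx_mul graph_gram_sym.
rewrite -/U -!mxtraceD DTE {1}DE; congr (\tr _).
rewrite !trmx_mul !trmxK /graph_gram mulmxDr mulmx1 mulmxDl -addrA; congr (_ + _).
rewrite !mulmxDl mul1mx !mulmxDr; congr (_ + _); by rewrite !mulmxA.
Qed.

Lemma mxtrace_graph_inv_le q W (D : 'M[R]_(q, K)) :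
  \tr (D *m invmx (G W) *m D^T) <= \tr (D *m D^T).
Proof.
rewrite (mxtrace_gram_graph_inv W D) -addrA lerDl addr_ge0//;
exact: mxtrace_gram_ge0.
Qed.

(** As [G W] is at least the identity, the trace of U U^T is at most that of U (G W) U^T, which is
    the form of the inverse at [D]. *)
Lemma mxtrace_graph_inv_gram_le q W (D : 'M[R]_(q, K)) (U := D *m invmx (G W)) :
  \tr (U *m U^T) <= \tr (D *m D^T).
Proof.
apply: le_trans (mxtrace_graph_inv_le W D).
have -> : D *m invmx (G W) *m D^T = U *m G W *m U^T.
  by rewrite /U mulmxKV ?graph_gram_unit// trmx_mul graph_gram_inv_sym !mulmxA.
rewrite /graph_gram mulmxDr mulmx1 mulmxDl mxtraceD lerDl.
rewrite mulmxA -(mulmxA (U *m W^T)) -{2}[W]trmxK -trmx_mul.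
exact: mxtrace_gram_ge0.
Qed.

(* Only the component of the graph of [W] orthogonal to the graph of [W']
   contributes, and it comes from [W - W'] alone. *)
Lemma mxtrace_graph_proj_ge W W' :
  K%:R - \tr (graph_proj W' *m graph_proj W) <= \tr ((W - W') *m (W - W')^T).
Proof.
pose D : 'M[R]_(K + p, K) := col_mx 0 (W - W').
pose Q := 1%:M - graph_proj W'.
have QW : Q *m graph_mx W = Q *m D.
  have -> : graph_mx W = graph_mx W' + D.
    by rewrite /graph_mx /D add_col_mx addr0 addrC subrK.
  by rewrite mulmxDr [Q *m graph_mx W']mulmxBl mul1mx graph_proj_mul subrr add0r.
have QQ : Q *m Q = Q.
  by rewrite {1}/Q mulmxBl mul1mx mulmxBr mulmx1 graph_proj_idem subrr subr0.
have QT : Q^T = Q by rewrite linearB /= trmx1 graph_proj_sym.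
have QY (Y : 'M[R]_(K + p, K)) : \tr (Q *m (Y *m invmx (G W) *m Y^T)) =
    \tr (Q *m Y *m invmx (G W) *m (Q *m Y)^T).
  by rewrite trmx_mul QT -{1}QQ -mulmxA mxtrace_mulC !mulmxA.
have -> : K%:R - \tr (graph_proj W' *m graph_proj W)
    = \tr (D *m invmx (G W) *m D^T *m Q).
  rewrite -(mxtrace_graph_proj W) -linearB /= -{1}[graph_proj W]mul1mx -mulmxBl.
  by rewrite -/Q QY QW -QY mxtrace_mulC.
(* Replacing [Q] by the identity discards the trace of D [invmx (G W)] D^T against the projector of
   [W']; the two Gram factorizations turn this term into the trace of X X^T, so it is
   nonnegative. *)
rewrite mulmxBr mulmx1 linearB /= (le_trans (y := \tr (D *m invmx (G W) *m D^T)))//.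
  have [A [uA AE ->]] := graph_gram_factor W.
  have [A' [uA' AE' NE']] := graph_gram_factor W'.
  rewrite gerBl mxtrace_mulC /graph_proj NE'.
  pose X := invmx A' *m (graph_mx W')^T *m D *m (invmx A)^T.
  suff -> : \tr (graph_mx W' *m ((invmx A')^T *m invmx A') *m (graph_mx W')^T *m
       (D *m ((invmx A)^T *m invmx A) *m D^T)) = \tr (X *m X^T).
    exact: mxtrace_gram_ge0.
  rewrite /X !trmx_mul !trmxK !mulmxA.
  by rewrite [RHS]mxtrace_mulC !mulmxA [RHS]mxtrace_mulC !mulmxA.
apply: le_trans (mxtrace_graph_inv_le W (W - W')).
rewrite /D mul_col_mx mul0mx tr_col_mx mul_col_row mxtrace_block.
by rewrite trmx0 mulmx0 mxtrace0 add0r.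
Qed.

Definition graph_entry W j k : R := (W *m invmx (G W)) j k.

Lemma graph_projE W j k : graph_proj W (rshift K j) (lshift p k) = graph_entry W j k.
Proof.
rewrite /graph_proj /graph_mx /graph_entry mul_col_mx tr_col_mx mul_col_row.
by rewrite block_mxEdl trmx1 mulmx1.
Qed.

(** The resolvent identity N - N' = N (G' - G) N' for the inverses N, N' of G = [G W] and G' =
    [G W']. It is exact for every x, and the rank one perturbation reduces each term to a product of
    single entries. *)
Lemma graph_entry_flip W j k (x : R) (W' := W + x *: delta_mx j k) :
  graph_entry W' j k - graph_entry W j k
  = x * ((1 - (W *m invmx (G W) *m W^T) j j) * invmx (G W') k k
         - graph_entry W j k * graph_entry W' j k).
Proof.
pose D := x *: delta_mx j k : 'M[R]_(p, K).
have E : W' *m invmx (G W') - W *m invmx (G W) =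
   (1%:M - W *m invmx (G W) *m W^T) *m D *m invmx (G W')
   - W *m invmx (G W) *m D^T *m (W' *m invmx (G W')).
  have W'E : W' = W + D by [].
  (* The quadratic term D^T D is absorbed by the [W'] in the last summand. *)
  have GE : G W' = G W + (W^T *m D + D^T *m W').
    rewrite /graph_gram W'E [(W + D)^T]linearD /= mulmxDl -W'E {1}W'E mulmxDr.
    by rewrite !addrA.
  have NE : invmx (G W) =
      invmx (G W') + invmx (G W) *m (W^T *m D + D^T *m W') *m invmx (G W').
    rewrite -[LHS](mulmxK (graph_gram_unit W')) GE mulmxDr mulmxDl.
    by rewrite mulVmx ?graph_gram_unit// mul1mx.
  have E1 : W' *m invmx (G W') = W *m invmx (G W') + D *m invmx (G W').
    by rewrite -mulmxDl -W'E.
  rewrite {1}E1 [X in _ - _ *m X]NE (mulmxDr W) opprD addrACA subrr add0r.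
  rewrite mulmxDr mulmxDl mulmxDr opprD addrA !mulmxBl mul1mx !mulmxA.
  by [].
rewrite /graph_entry.
have {}E := congr1 (fun A : 'M[R]_(p, K) => A j k) E.
have mxBE m n (A B : 'M[R]_(m, n)) i l : (A - B) i l = A i l - B i l by rewrite !mxE.
rewrite !mxBE in E; rewrite {}E /D [(x *: _)^T]linearZ /= trmx_delta.
rewrite !mulmx_delta_mxE mxBE mxE eqxx.
by rewrite [RHS]mulrBr !mulrA.
Qed.

(** Cauchy-Schwarz: row k of A and column k of A^-1 have inner product 1, and their squared norms
    are the diagonal entries of [G W] and of its inverse. *)
Lemma graph_gram_inv_diag_ge W k : (G W k k)^-1 <= invmx (G W) k k.
Proof.
have [A [uA AE ->]] := graph_gram_factor W.
pose r := row k A; pose s := row k (invmx A)^T.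
have rr : G W k k = \tr (r *m r^T) by rewrite -AE mulmx_tr_diagE.
have ss : ((invmx A)^T *m invmx A) k k = \tr (s *m s^T).
  by rewrite -{2}[invmx A]trmxK mulmx_tr_diagE.
have rs : \tr (r *m s^T) = 1.
  by rewrite -mulmx_tr_diagE trmxK mulmxV// mxE eqxx.
rewrite rr ss; set u := \tr (r *m r^T).
have u0 : 0 < u.
  apply: mxtrace_gram_gt0; apply/eqP => r0; move: rs.
  by rewrite r0 mul0mx mxtrace0 => /esym/eqP; rewrite oner_eq0.
have := mxtrace_gram_ge0 (s - u^-1 *: r).
have -> : (s - u^-1 *: r)^T = s^T - u^-1 *: r^T by rewrite [LHS]linearB /= linearZ.
rewrite mulmxBl !mulmxBr -!scalemxAl -!scalemxAr !mxtraceB !mxtraceZ.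
rewrite rs -/u -[\tr (s *m r^T)]mxtrace_tr trmx_mul trmxK rs mulr1 mulVf ?gt_eqF//.
by rewrite mulr1 subrr subr0 subr_ge0.
Qed.

Lemma ler_norm_mul_sqr (x y c : R) :
  x ^+ 2 <= c -> y ^+ 2 <= c -> `|x * y| <= c.
Proof.
move=> xc yc; have := sqr_ge0 (x - y); have := sqr_ge0 (x + y).
rewrite sqrrB sqrrD ler_norml => D1 D2.
by apply/andP; split; lra.
Qed.

Lemma sqr_entry_le n (x : 'rV[R]_n) k : x 0 k ^+ 2 <= \tr (x *m x^T).
Proof.
rewrite trace_mx11 mxE (bigD1 k)//= mxE -expr2 lerDl sumr_ge0// => j _.
by rewrite mxE -expr2 sqr_ge0.
Qed.

(** The inverse of [G W] is a contraction acting on row j of [W], so only the norm of that row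
    enters. *)
Lemma sqr_graph_entry_le W j k :
  graph_entry W j k ^+ 2 <= \sum_l W j l ^+ 2.
Proof.
have -> : \sum_l W j l ^+ 2 = \tr (row j W *m (row j W)^T).
  by rewrite trace_mx11 mxE; apply: eq_bigr => l _; rewrite !mxE.
apply: le_trans (mxtrace_graph_inv_gram_le W (row j W)).
have -> : graph_entry W j k = (row j W *m invmx (G W)) 0 k.
  by rewrite -row_mul mxE.
exact: sqr_entry_le.
Qed.

(* Without any control of the operator norm of [W], which is not small for all
   sign patterns; this is what allows the full cube of signs. *)
Lemma graph_entry_flip_ge W (t : R) j k (W' := W - (2 * W j k) *: delta_mx j k) :
  0 <= t -> (forall a b, `|W a b| = t) ->
  (K + p)%:R * t ^+ 2 <= 8^-1 ->
  t <= `|graph_entry W' j k - graph_entry W j k|.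
Proof.
move=> t0 Wt Kp.
have W't a b : `|W' a b| = t.
  rewrite !mxE; case: (eqVneq a j) => [->|_]; last by rewrite mulr0 subr0.
  case: (eqVneq b k) => [->|_]; last by rewrite mulr0 subr0.
  by rewrite mulr1 mulr_natl mulr2n opprD addrA subrr sub0r normrN.
have sq (x : R) : `|x| = t -> x ^+ 2 = t ^+ 2.
  by move=> <-; rewrite real_normK// num_real.
have Kt : K%:R * t ^+ 2 <= 8^-1.
  by apply: le_trans Kp; rewrite ler_wpM2r ?sqr_ge0// ler_nat leq_addr.
have pt : p%:R * t ^+ 2 <= 8^-1.
  by apply: le_trans Kp; rewrite ler_wpM2r ?sqr_ge0// ler_nat leq_addl.
have sumK (V : 'M[R]_(p, K)) : (forall a b, `|V a b| = t) ->
    \sum_l V j l ^+ 2 = K%:R * t ^+ 2.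
  move=> Vt; under eq_bigr do rewrite sq//.
  by rewrite sumr_const card_ord mulr_natl.
have F1 := sqr_graph_entry_le W j k.
have F2 := sqr_graph_entry_le W' j k.
rewrite sumK// in F1; rewrite sumK// in F2.
have FF : `|graph_entry W j k * graph_entry W' j k| <= 8^-1.
  set f := graph_entry W j k in F1 *; set f' := graph_entry W' j k in F2 *.
  exact: ler_norm_mul_sqr (le_trans F1 Kt) (le_trans F2 Kt).
(* This diagonal entry is the form of [invmx (G W)] at row j, at most the squared norm K t^2 of that
   row. *)
have q1 : (W *m invmx (G W) *m W^T) j j <= 8^-1.
  rewrite mulmx_tr_diagE row_mul; apply: le_trans (mxtrace_graph_inv_le _ _) _.
  rewrite trace_mx11 mxE; under eq_bigr do rewrite !mxE -expr2.
  by rewrite sumK.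
(* [G W' k k] is 1 plus the squared norm p t^2 of column k, hence at most 9/8. *)
have q2 : 8 / 9 <= invmx (G W') k k.
  apply: le_trans (graph_gram_inv_diag_ge W' k).
  have -> : G W' k k = 1 + p%:R * t ^+ 2.
    rewrite mxE mxE eqxx mxE; congr (_ + _).
    under eq_bigr do rewrite mxE -expr2 sq//.
    by rewrite sumr_const card_ord mulr_natl.
  have pt0 : 0 <= p%:R * t ^+ 2 by rewrite mulr_ge0 ?sqr_ge0.
  rewrite -[8 / 9]invrK lef_pV2 ?posrE; [|lra|lra].
    by rewrite invf_div; lra.
have -> : graph_entry W' j k - graph_entry W j k = - (2 * W j k) *
    ((1 - (W *m invmx (G W) *m W^T) j j) * invmx (G W') k k
     - graph_entry W j k * graph_entry W' j k).
  by rewrite /W' -scaleNr graph_entry_flip.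
rewrite normrM normrN normrM Wt ger0_norm// mulrAC -[leLHS]mul1r.
apply: ler_wpM2r => //; move: FF q1 q2.
set a := _ j j; set b := invmx _ _ _; set f := (X in `|X|) => FF q1 q2.
apply: le_trans (ler_wpM2l _ (ler_norm _)) => //.
move: FF; rewrite ler_norml => /andP[_ FF].
(* The sign flip changes the entry of W by 2 t, so a factor of at least 1/2 is enough; here 7/8 *
   8/9 - 1/8 = 47/72. *)
have : (7 / 8) * (8 / 9) <= (1 - a) * b by apply: ler_pM => //; lra.
rewrite -/f; clearbody a b f; lra.
Qed.

End graph_projector.

(** * Finite product probabilities *)

Section image_probability.
Context {d d'} {T : measurableType d} {T' : measurableType d'} {R : realType}.

Definition image_prob (P : probability T R) (f : T -> T')
    (mf : measurable_fun setT f) : probability T' R :=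
  distribution P (mfun_Sub (mem_set mf)).

Lemma image_probE (P : probability T R) (f : T -> T') (mf : measurable_fun setT f) A :
  image_prob P mf A = P (f @^-1` A).
Proof. by []. Qed.

Lemma ge0_integral_image_prob (P : probability T R) (f : T -> T')
    (mf : measurable_fun setT f) (g : T' -> \bar R) :
  measurable_fun [set: T'] g -> (forall y, 0 <= g y)%E ->
  (\int[image_prob P mf]_y g y = \int[P]_x g (f x))%E.
Proof. by move=> mg g0; rewrite ge0_integral_distribution. Qed.

Lemma integral_image_prob (P : probability T R)
    (f : T -> T') (mf : measurable_fun setT f) (g : T' -> \bar R) :
  (image_prob P mf).-integrable setT g ->
  P.-integrable setT (g \o f) /\
  (\int[P]_x g (f x) = \int[image_prob P mf]_y g y)%E.
Proof.
move=> ig; have mg := measurable_int _ ig.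
have igf : P.-integrable setT (g \o f).
  apply/integrableP; split; first exact: (measurableT_comp mg mf).
  move/integrableP: ig => [_]; rewrite ge0_integral_image_prob//.
  exact: measurableT_comp.
split => //.
have := @integral_pushforward _ _ _ _ _ f mf P setT g mg igf measurableT.
by rewrite preimage_setT => <-.
Qed.

End image_probability.

Section tuple_probability.
Context {d} {T : measurableType d} {R : realType}.

Lemma measurable_tuple_cons n :
  measurable_fun setT (fun xt : T * n.-tuple T => [tuple of xt.1 :: xt.2]).
Proof. exact: measurable_cons. Qed.

(** The product law is built one coordinate at a time, so that each induction step is Tonelli's
    theorem for a product of two measures. *)
Fixpoint tuple_prob n : ('I_n -> probability T R) -> probability (n.-tuple T) R :=
  match n return ('I_n -> probability T R) -> probability (n.-tuple T) R with
  | 0 => fun=> dirac [tuple]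
  | n.+1 => fun mu =>
      image_prob (mu ord0 \x tuple_prob (fun i => mu (lift ord0 i)))%E
                 (@measurable_tuple_cons n)
  end.

Lemma ge0_integral_tuple_prob (n : nat) (mu : 'I_n.+1 -> probability T R)
    (f : n.+1.-tuple T -> \bar R) :
  measurable_fun [set: _.-tuple T] f -> (forall t, 0 <= f t)%E ->
  (\int[tuple_prob mu]_t f t = \int[mu ord0]_x
     \int[tuple_prob (fun i => mu (lift ord0 i))]_t f [tuple of x :: t])%E.
Proof.
move=> mf f0; rewrite [LHS]ge0_integral_image_prob//.
rewrite [LHS]fubini_tonelli1//.
exact: measurableT_comp mf (@measurable_tuple_cons n).
Qed.

Lemma measurable_tuple_rect n (B : 'I_n -> set T) :
  (forall i, measurable (B i)) ->
  measurable [set t : n.-tuple T | forall i, B i (tnth t i)].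
Proof.
move=> mB.
rewrite (_ : [set _ | _] = \bigcap_(i in [set: 'I_n]) ((@tnth n T)^~ i @^-1` B i)).
  apply: fin_bigcap_measurable => // i _.
  by rewrite -[X in measurable X]setTI; exact: measurable_tnth.
by apply/seteqP; split => t /= h i; [move=> _|]; exact: h.
Qed.

Lemma tuple_prob_rect n (mu : 'I_n -> probability T R) (B : 'I_n -> set T) :
  (forall i, measurable (B i)) ->
  tuple_prob mu [set t | forall i, B i (tnth t i)] = (\prod_(i < n) mu i (B i))%E.
Proof.
elim: n mu B => [|n IH] mu B mB.
  by rewrite big_ord0/= diracE mem_set// => -[].
rewrite big_ord_recl -IH// [LHS]image_probE.
rewrite -[RHS]product_measure1E//; last first.
  by apply: (@measurable_tuple_rect n (fun i => B (lift ord0 i))) => i; exact: mB.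
congr (product_measure1 _ _ _); apply/seteqP; split => -[x t]/=.
  move=> h; split; first exact: (h ord0).
  by move=> i; have := h (lift ord0 i); rewrite tnthS.
by case=> hx ht i; case: (unliftP ord0 i) => [j ->|->//]; rewrite tnthS.
Qed.

Lemma tuple_prob_tnth n (mu : 'I_n -> probability T R) i A : measurable A ->
  tuple_prob mu ((@tnth n T)^~ i @^-1` A) = mu i A.
Proof.
move=> mA; pose B j := if j == i then A else setT.
have -> : (@tnth n T)^~ i @^-1` A = [set t | forall j, B j (tnth t j)].
  apply/seteqP; split => t /=.
    by move=> h j; rewrite /B; case: eqP => // ->.
  by move/(_ i); rewrite /B eqxx.
rewrite tuple_prob_rect => [|j]; last by rewrite /B; case: ifP.
rewrite (bigD1 i)//= /B eqxx big1 ?mule1// => j /negbTE ->.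
exact: probability_setT.
Qed.

(** Densities multiply over independent coordinates: the induction hypothesis treats the tail for a
    fixed head, and the density of the head is then applied to the integrated tail. *)
Lemma tuple_prob_density n (mu mu' : 'I_n -> probability T R) (g : 'I_n -> T -> R) :
  (forall i, measurable_fun setT (g i)) -> (forall i x, 0 <= g i x) ->
  (forall i f, measurable_fun [set: T] f -> (forall x, 0 <= f x)%E ->
    \int[mu' i]_x f x = \int[mu i]_x (f x * (g i x)%:E))%E ->
  forall f, measurable_fun [set: _.-tuple T] f -> (forall t, 0 <= f t)%E ->
  (\int[tuple_prob mu']_t f t =
   \int[tuple_prob mu]_t (f t * (\prod_(i < n) g i (tnth t i))%:E))%E.
Proof.
move=> mg g0 dens.
have mprod k (h : 'I_k -> T -> R) : (forall i, measurable_fun setT (h i)) ->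
    measurable_fun setT (fun t : k.-tuple T => \prod_(i < k) h i (tnth t i)).
  move=> mh; apply: measurable_prod => i _.
  exact: measurableT_comp (mh i) (measurable_tnth i).
elim: n mu mu' g mg g0 dens => [|n IH] mu mu' g mg g0 dens f mf f0.
  by apply: eq_integral => t _; rewrite big_ord0 mule1.
rewrite !ge0_integral_tuple_prob//; first last.
- by move=> t; rewrite mule_ge0// lee_fin prodr_ge0.
- by apply: emeasurable_funM => //; apply/measurable_EFinP; exact: mprod.
have mfc : measurable_fun setT (fun xt : T * n.-tuple T => f [tuple of xt.1 :: xt.2]).
  exact: measurableT_comp mf (@measurable_tuple_cons n).
pose pg (t : n.-tuple T) := \prod_(i < n) g (lift ord0 i) (tnth t i).
have mpg : measurable_fun setT pg.
  by apply: (@mprod n (fun i => g (lift ord0 i))) => i; exact: mg.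
have pg0 t : 0 <= pg t by exact: prodr_ge0.
have IHx x : (\int[tuple_prob (fun i => mu' (lift ord0 i))]_t f [tuple of x :: t] =
    \int[tuple_prob (fun i => mu (lift ord0 i))]_t
      (f [tuple of x :: t] * (pg t)%:E))%E.
  apply: (IH _ _ (fun i => g (lift ord0 i))) => // [i|].
    exact: dens.
  exact: (measurableT_comp mfc (pair1_measurable x)).
under eq_integral do rewrite IHx.
pose F (xt : T * n.-tuple T) := (f [tuple of xt.1 :: xt.2] * (pg xt.2)%:E)%E.
have mF : measurable_fun setT F.
  apply: emeasurable_funM => //; apply/measurable_EFinP.
  exact: measurableT_comp.
have F0 xt : (0 <= F xt)%E by rewrite mule_ge0// lee_fin.
rewrite dens; first last.
- by move=> x; apply: integral_ge0 => t _; exact: (F0 (x, t)).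
- exact: (measurable_fun_fubini_tonelli_F _ mF).
apply: eq_integral => x _; rewrite -ge0_integralZr//; first last.
- by rewrite lee_fin.
- by move=> t _; exact: (F0 (x, t)).
- exact: (measurableT_comp mF (pair1_measurable x)).
apply: eq_integral => t _; rewrite big_ord_recl/= EFinM -muleA; congr (_ * _)%E.
rewrite muleC; congr (_ * _%:E)%E; apply: eq_bigr => i _; by rewrite tnthS.
Qed.

End tuple_probability.

(** * Independence of disjoint subfamilies *)

Section independence_lemmas.
Context {d d'} {Omega : measurableType d} {T : measurableType d'}.
Context {R : realType} {I : finType}.
Variables (P : probability Omega R) (X : I -> Omega -> T).
Hypothesis mX : forall i, measurable_fun setT (X i).

Lemma measurable_rect (J : {set I}) (B : I -> set T) :
  (forall i, measurable (B i)) ->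
  measurable [set w | forall i, i \in J -> B i (X i w)].
Proof.
move=> mB.
rewrite (_ : [set _ | _] = \bigcap_(i in [set` J]) (X i @^-1` B i)).
  apply: fin_bigcap_measurable => // i _.
  by rewrite -[X in measurable X]setTI; exact: mX.
by apply/seteqP; split => w /= h i; exact: h.
Qed.

Lemma mutually_independentS J :
  mutually_independent P [set: I]%SET X -> mutually_independent P J X.
Proof.
move=> indep B mB; pose B' i := if i \in J then B i else setT.
rewrite (_ : [set _ | _] = [set w | forall i, i \in [set: I]%SET -> B' i (X i w)]).
  rewrite indep => [|i]; last by rewrite /B'; case: ifP.
  rewrite [RHS]big_mkcond/=; apply: eq_big => [i|i _]; first by rewrite !inE.
  rewrite /B'; case: ifP => // _.
  by rewrite preimage_setT probability_setT.
apply/seteqP; split => w /= h i.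
  by move=> _; rewrite /B'; case: ifPn => // /h.
by move=> iJ; have := h i (finset.in_setT _); rewrite /B' iJ.
Qed.

(** The finite measures A -> P (A [&] E) and A -> P A * P E agree on the pi-system [G], hence on the
    sigma-algebra that it generates. *)
Lemma independent_sigma (G : set (set Omega)) E :
  measurable E -> G `<=` measurable -> setI_closed G -> G setT ->
  (forall A, G A -> P (A `&` E) = P A * P E)%E ->
  forall A, <<s G >> A -> (P (A `&` E) = P A * P E)%E.
Proof.
move=> mE Gm GI GT PG A sA.
have PE0 : 0 <= fine (P E) by exact: fine_ge0.
have PEE : P E = (fine (P E))%:E by rewrite fineK// fin_num_measure.
pose m1 : {measure set Omega -> \bar R} := mrestr P mE.
pose m2 : {measure set Omega -> \bar R} := mscale (NngNum PE0) P.
have m2E B : m2 B = (P B * P E)%E by rewrite /m2 /= /mscale /= -PEE muleC.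
rewrite -m2E -[LHS]/(m1 A).
apply: (g_sigma_algebra_measure_unique G Gm (fun=> setT)) => //.
- by rewrite bigcup_const//; exists 0%N.
- by move=> B GB; rewrite m2E; exact: PG.
- move=> _; rewrite /m1 /= /mrestr setTI.
  by rewrite (le_lt_trans (probability_le1 _ _))// ltry.
Qed.

(** [independent_sigma] is applied once on each side. The generators are first enlarged to
    rectangles, because preimages under single variables are not closed under intersection. *)
Lemma independent_familiesP (J J' : {set I}) : [disjoint J & J']%B ->
  mutually_independent P [set: I]%SET X -> independent_families P J J' X.
Proof.
move=> JJ' indep A A' sA sA'.
pose rect (L : {set I}) : set (set Omega) :=
  [set E | exists2 B : I -> set T, (forall i, measurable (B i)) &
     E = [set w | forall i, i \in L -> B i (X i w)]].
have rectm L : rect L `<=` measurable by move=> _ [B mB ->]; exact: measurable_rect.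
have rectI L : setI_closed (rect L).
  move=> _ _ [B mB ->] [C mC ->]; exists (fun i => B i `&` C i).
    by move=> i; exact: measurableI.
  apply/seteqP; split => w /=.
    by move=> [hB hC] i iL; split; [exact: hB|exact: hC].
  by move=> h; split => i iL; have [] := h i iL.
have rectT L : rect L setT.
  by exists (fun=> setT) => //; apply/seteqP; split.
have sub L E : sigma_generated L X E -> <<s rect L >> E.
  apply: sub_sigma_algebra2 => _ [i iL [B mB ->]].
  exists (fun j => if j == i then B else setT); first by move=> j; case: ifP.
  apply/seteqP; split => w /= h; last by have := h i iL; rewrite eqxx.
  by move=> j _; case: eqP => // ->.
have mP L E : <<s rect L >> E -> measurable E.
  by apply: smallest_sub; [exact: sigma_algebra_measurable|exact: rectm].
have {}sA := sub _ _ sA; have {}sA' := sub _ _ sA'.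
apply: (independent_sigma (mP _ _ sA') (rectm J)) => //.
move=> _ [B mB ->]; set E := [set _ | _].
have mE : measurable E by exact: measurable_rect.
rewrite setIC muleC.
apply: (independent_sigma mE (rectm J')) => //.
move=> _ [C mC ->]; rewrite /E.
(* Disjointness of [J] and [J'] makes the two rectangles the restrictions of a single one. *)
pose D i := if i \in J then B i else C i.
have mD i : measurable (D i) by rewrite /D; case: ifP.
rewrite (_ : _ `&` _ = [set w | forall i, i \in J :|: J' -> D i (X i w)]).
  rewrite !mutually_independentS// muleC.
  rewrite (eq_bigl [predU J & J']) => [|i]; last by rewrite !inE.
  rewrite bigU//=; congr (_ * _)%E; apply: eq_bigr => i iL.
    by rewrite /D iL.
  by rewrite /D (disjointFl JJ' iL).
apply/seteqP; split => w /=.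
  move=> [hC hB] i; rewrite inE /D; case: ifPn => [iJ _|_ /= iJ'].
    exact: hB.
  exact: hC.
move=> h; split => i iL; have := h i; rewrite /D inE iL ?orbT.
  by rewrite (disjointFl JJ' iL); exact.
exact.
Qed.

End independence_lemmas.

(** * The standard normal distribution *)

Section density.
Local Open Scope ereal_scope.
Context {d} {T : measurableType d} {R : realType}.
Variables (mu nu : {measure set T -> \bar R}) (g : T -> R).
Hypotheses (mg : measurable_fun [set: T] g) (g0 : forall x, (0 <= g x)%R).
Hypothesis nuE : forall A, measurable A -> nu A = \int[mu]_(x in A) (g x)%:E.
Import HBNNSimple.

Lemma ge0_integral_density (f : T -> \bar R) :
  measurable_fun [set: T] f -> (forall x, 0 <= f x) ->
  \int[nu]_x f x = \int[mu]_x (f x * (g x)%:E).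
Proof.
move=> mf f0; pose f_ := nnsfun_approx measurableT mf.
transitivity (limn (fun n => \int[nu]_x (f_ n x)%:E)).
  rewrite -monotone_convergence//.
  - by apply: eq_integral => y _; apply/esym/cvg_lim => //; exact: cvg_nnsfun_approx.
  - by move=> n; exact/measurable_EFinP.
  - by move=> n y _; rewrite lee_fin.
  - by move=> y _ m n mn; rewrite lee_fin; exact/lefP/nd_nnsfun_approx.
rewrite [X in limn X](_ : _ = (fun n => \int[mu]_x ((f_ n x)%:E * (g x)%:E))).
  rewrite -monotone_convergence//.
  - apply: eq_integral => x _; apply/cvg_lim => //.
    under eq_fun do rewrite muleC.
    rewrite muleC; apply: cvgeMl; last exact: cvg_nnsfun_approx.
    by [].
  - by move=> n; apply: emeasurable_funM; exact/measurable_EFinP.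
  - by move=> n y _; rewrite mule_ge0// lee_fin.
  - by move=> y _ m n mn; rewrite lee_wpmul2r ?lee_fin//; exact/lefP/nd_nnsfun_approx.
apply/funext => n.
transitivity (\sum_(k \in range (f_ n))
    \int[nu]_x (k * \1_(f_ n @^-1` [set k]) x)%:E).
  under eq_integral do rewrite fimfunE -fsumEFin//.
  rewrite ge0_integral_fsum//.
  - by move=> y; exact/measurable_EFinP/measurable_funM.
  - by move=> y x _; rewrite nnfun_muleindic_ge0.
transitivity (\sum_(k \in range (f_ n))
    \int[mu]_x ((k * \1_(f_ n @^-1` [set k]) x)%:E * (g x)%:E)).
  apply: eq_fsbigr => r _; rewrite integralZl_indic_nnsfun// integral_indic//=.
  rewrite setIT nuE//.
  have [r0|r0] := leP 0%R r.
    rewrite -ge0_integralZl//=; last 2 first.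
    - exact/measurable_EFinP/measurable_funTS.
    - by move=> x _; rewrite lee_fin.
    rewrite [LHS]integral_mkcond; apply: eq_integral => x _; rewrite patchE indicE.
    by case: ifPn => _; rewrite ?mulr1// mulr0 mul0e.
  rewrite preimage_nnfun0// integral_set0 mule0.
  by rewrite integral0_eq// => x _; rewrite indic0 mulr0 mul0e.
rewrite -ge0_integral_fsum//.
- apply: eq_integral => x _; rewrite [in RHS]fimfunE -fsumEFin// ge0_mule_fsuml//.
  by move=> r; rewrite nnfun_muleindic_ge0.
- move=> r; apply: emeasurable_funM; last exact/measurable_EFinP.
  exact/measurable_EFinP/measurable_funM.
- by move=> r x _; rewrite mule_ge0 ?lee_fin// -lee_fin EFinM nnfun_muleindic_ge0.
Qed.

End density.

Section lebesgue_affine.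
Context {R : realType}.
Local Notation leb := (@lebesgue_measure R).

(** The push-forward of Lebesgue measure by the affine map, multiplied by r, agrees with Lebesgue
    measure on half-open intervals, hence everywhere. *)
Lemma ge0_integral_lebesgue_affine (r b : R) (f : R -> \bar R) : 0 < r ->
  measurable_fun [set: R] f -> (forall x, 0 <= f x)%E ->
  (\int[leb]_x f x = r%:E * \int[leb]_x f (r * x + b)%R)%E.
Proof.
move=> r0 mf f0; pose phi (x : measurableTypeR R) : measurableTypeR R := r * x + b.
have mphi : measurable_fun setT phi.
  by apply: measurable_funD => //; exact: measurable_funM.
have := ge0_integral_pushforward mphi leb measurableT mf (fun x _ => f0 x).
rewrite preimage_setT /comp => <-.
have r0' : 0 <= r by exact: ltW.
rewrite -[r%:E]/((NngNum r0')%:num%:E) -ge0_integral_mscale//.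
apply: eq_measure_integral => A mA _.
apply: lebesgue_measure_unique => //= _ [[x y]] _ <-.
rewrite /mscale/= /pushforward.
have -> : phi @^-1` [set` `]x, y]] = [set` `](x - b) / r, (y - b) / r]].
  apply/seteqP; split => z /=; rewrite !in_itv/= /phi.
    by rewrite ltr_pdivrMr// ler_pdivlMr// ltrBlDr lerBrDr (mulrC z).
  by rewrite ltr_pdivrMr// ler_pdivlMr// ltrBlDr lerBrDr (mulrC z).
rewrite !lebesgue_measure_itv/= !lte_fin ltr_pM2r ?invr_gt0// ltrD2r.
case: ifP => xy; last by rewrite mule0.
rewrite -!EFinB -EFinM; congr EFin; field.
by rewrite gt_eqF.
Qed.

End lebesgue_affine.

Section standard_normal.
Context {R : realType}.
Local Notation leb := (@lebesgue_measure R).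
Local Notation N01 := (normal_prob (0 : R) 1).

Lemma ge0_integral_normal (f : R -> \bar R) :
  measurable_fun [set: R] f -> (forall x, 0 <= f x)%E ->
  (\int[N01]_x f x = \int[leb]_x (f x * (normal_pdf 0 1 x)%:E))%E.
Proof.
exact: (ge0_integral_density (mu := leb) (nu := N01) (measurable_normal_pdf 0 1)
  (normal_pdf_ge0 0 1)).
Qed.

(** The Jacobian and the ratio of the two normal densities are kept in the integrand, so both sides
    are integrals against N(0, 1) and the formula can be iterated over coordinates. *)
Lemma ge0_integral_normal_affine (r b : R) (f : R -> \bar R) : 0 < r ->
  measurable_fun [set: R] f -> (forall x, 0 <= f x)%E ->
  (\int[N01]_x f x =
   r%:E * \int[N01]_x (f (r * x + b)%R * (expR ((x ^+ 2 - (r * x + b) ^+ 2) / 2))%:E))%E.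
Proof.
move=> r0 mf f0.
have maff : measurable_fun setT (fun x : measurableTypeR R => r * x + b).
  by apply: measurable_funD => //; exact: measurable_funM.
have mexp : measurable_fun setT
    (fun x : measurableTypeR R => expR ((x ^+ 2 - (r * x + b) ^+ 2) / 2)).
  apply: measurableT_comp => //; apply: measurable_funM => //.
  by apply: measurable_funB; apply: measurable_funX.
rewrite [LHS]ge0_integral_normal// (ge0_integral_lebesgue_affine b r0); first last.
- by move=> x; rewrite mule_ge0// lee_fin normal_pdf_ge0.
- apply: emeasurable_funM => //; apply/measurable_EFinP.
  exact: measurable_normal_pdf.
congr (_ * _)%E; rewrite ge0_integral_normal; first last.
- by move=> x; rewrite mule_ge0// lee_fin expR_ge0.
- apply: emeasurable_funM; first exact: (measurableT_comp mf maff).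
  exact/measurable_EFinP.
apply: eq_integral => x _; rewrite -muleA -EFinM; congr (_ * _%:E)%E.
rewrite !normal_pdfE// /normal_fun !subr0 mulrCA -expRD; congr (_ * expR _).
by rewrite expr1n; field.
Qed.

(** This is the change of variables with ratio 1/sqrt 2 for the constant function 1. The finite
    exponential moment gives the integrability of x^2. *)
Lemma integral_normal_expR_sqr :
  (\int[N01]_x (expR (x ^+ 2 / 4))%:E = (Num.sqrt 2)%:E)%E.
Proof.
have r0 : 0 < (Num.sqrt 2)^-1 :> R by rewrite invr_gt0 sqrtr_gt0.
have r2 : (Num.sqrt 2)^-1 ^+ 2 = 2^-1 :> R by rewrite exprVn sqr_sqrtr.
have := ge0_integral_normal_affine 0 r0 (measurable_cst (1%E : \bar R)) (fun=> lee01).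
rewrite integral_cst// mul1e [X in X = _](probability_setT N01) => h.
have {}h : (1 = (Num.sqrt 2)^-1%:E * \int[N01]_x (expR (x ^+ 2 / 4))%:E)%E.
  rewrite [LHS]h; congr (_ * _)%E; apply: eq_integral => x _.
  rewrite mul1e addr0 exprMn r2.
  by congr (expR _)%:E; field.
have s0 : Num.sqrt 2 != 0 :> R by rewrite gt_eqF// sqrtr_gt0.
by rewrite -[RHS]mule1 [X in _ = (_ * X)%E]h muleA -EFinM divff// mul1e.
Qed.

Lemma integrable_normal_sqr : N01.-integrable setT (fun x : R => (x ^+ 2)%:E).
Proof.
apply: (@le_integrable _ _ _ (N01 : {measure set _ -> \bar R}) _ measurableT _
   (fun x : R => (4 * expR (x ^+ 2 / 4))%:E)) => //.
- by apply/measurable_EFinP; exact: measurable_funX.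
- move=> x _; rewrite lee_fin !ger0_norm ?sqr_ge0 ?mulr_ge0 ?expR_ge0//.
  have := expR_ge1Dx (x ^+ 2 / 4); lra.
- apply/integrableP; split.
    apply/measurable_EFinP/measurable_funM => //; apply: measurableT_comp => //.
    by apply: measurable_funM => //; exact: measurable_funX.
  under eq_integral do rewrite gee0_abs ?lee_fin ?mulr_ge0 ?expR_ge0// EFinM.
  rewrite ge0_integralZl//= ?integral_normal_expR_sqr ?ltry//.
  apply/measurable_EFinP; apply: measurableT_comp => //.
  by apply: measurable_funM => //; exact: measurable_funX.
Qed.

Lemma integrable_normal_id : N01.-integrable setT (fun x : R => x%:E).
Proof.
apply: (@le_integrable _ _ _ (N01 : {measure set _ -> \bar R}) _ measurableT _
   (fun x : R => (1 + x ^+ 2)%:E)) => //.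
- exact/measurable_EFinP.
- move=> x _; rewrite lee_fin [leRHS]ger0_norm ?addr_ge0 ?sqr_ge0//.
  by rewrite ler_norml; apply/andP; split; nra.
under eq_fun do rewrite EFinD.
apply: integrableD => //; last exact: integrable_normal_sqr.
exact: finite_measure_integrable_cst.
Qed.

(** Kept symbolic: it scales every mean of a log-likelihood ratio and enters the final constants
    through [testing_bound]. *)
Definition normal_moment2 : R := fine (\int[N01]_x (x ^+ 2)%:E).

Lemma integral_normal_sqr : (\int[N01]_x (x ^+ 2)%:E = normal_moment2%:E)%E.
Proof.
by rewrite /normal_moment2 fineK// integrable_fin_num//; exact: integrable_normal_sqr.
Qed.

Lemma normal_moment2_ge0 : 0 <= normal_moment2.
Proof. by apply: fine_ge0; apply: integral_ge0 => x _; rewrite lee_fin sqr_ge0. Qed.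

Lemma ge0_integral_normalN (f : R -> \bar R) :
  measurable_fun [set: R] f -> (forall x, 0 <= f x)%E ->
  (\int[N01]_x f (- x)%R = \int[N01]_x f x)%E.
Proof.
move=> mf f0.
pose opp (x : measurableTypeR R) : measurableTypeR R := - x.
have mopp : measurable_fun setT opp by exact: oppr_measurable.
rewrite !ge0_integral_normal//; last exact: (measurableT_comp mf mopp).
pose F (x : measurableTypeR R) := (f x * (normal_pdf 0 1 x)%:E)%E.
have mF : measurable_fun setT F.
  apply: emeasurable_funM => //; apply/measurable_EFinP.
  exact: measurable_normal_pdf.
have F0 x : (0 <= F x)%E by rewrite mule_ge0// lee_fin normal_pdf_ge0.
transitivity (\int[pushforward leb opp]_x F x)%E; last first.
  by apply: eq_measure_integral => A mA _; exact: lebesgue_measureN.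
have := ge0_integral_pushforward mopp leb measurableT mF (fun x _ => F0 x).
rewrite preimage_setT /comp => ->.
apply: eq_integral => x _; rewrite /F/=; congr (_ * _%:E)%E.
by rewrite !normal_pdfE// /normal_fun !subr0 sqrrN.
Qed.

(** By symmetry the positive and negative parts have the same integral, and integrability makes it
    finite, so that the two cancel. *)
Lemma integral_normal_id : (\int[N01]_x x%:E = 0)%E.
Proof.
rewrite integralE.
have -> : (\int[N01]_x (EFin^\- x) = \int[N01]_x (EFin^\+ x))%E.
  rewrite -[RHS]ge0_integral_normalN//.
    by apply: eq_integral => x _; rewrite funenegE funeposE EFinN.
  by apply: measurable_funepos; exact/measurable_EFinP.
by rewrite subee// integrable_pos_fin_num//; exact: integrable_normal_id.
Qed.

End standard_normal.

(** * Gaussian row vectors *)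

Section measurable_matrices.
Context {R : realType}.

Lemma measurable_mx_entry p q (i : 'I_p) (j : 'I_q) :
  measurable_fun [set: 'M[R]_(p, q)] (fun M => (M i j : R)).
Proof.
move=> _ B mB; rewrite setTI; apply: sub_sigma_algebra.
by exists i, j, B.
Qed.

Lemma measurable_fun_mx {d} {T : measurableType d} p q (f : T -> 'M[R]_(p, q)) :
  (forall i j, measurable_fun [set: T] (fun w => f w i j : R)) ->
  measurable_fun [set: T] f.
Proof.
move=> mf; apply: (measurability (@matrix_cylinder _ R p q)) => //.
move=> _ [_ [i [j [B mB ->]]] <-].
rewrite setTI; have := mf i j measurableT B mB; rewrite setTI.
exact.
Qed.

Lemma measurable_mx_mulD p q r (A : 'M[R]_(q, r)) (b : 'M[R]_(p, r)) :
  measurable_fun setT (fun z : 'M[R]_(p, q) => z *m A + b).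
Proof.
apply: measurable_fun_mx => i j.
under eq_fun do rewrite mxE mxE.
apply: measurable_funD => //; apply: measurable_sum => k.
by apply: measurable_funM => //; exact: measurable_mx_entry.
Qed.

Lemma measurable_mx_mul p q r (A : 'M[R]_(q, r)) :
  measurable_fun setT (fun z : 'M[R]_(p, q) => z *m A).
Proof.
have := measurable_mx_mulD A (0 : 'M[R]_(p, r)).
by under eq_fun do rewrite addr0.
Qed.

Lemma measurable_mx_quad p q (A : 'M[R]_q) :
  measurable_fun setT (fun z : 'M[R]_(p, q) => (\tr (z *m A *m z^T) : R)).
Proof.
under eq_fun do rewrite mxtrace_mul_trE.
apply: measurable_sum => i; apply: measurable_sum => j.
apply: measurable_funM; last exact: measurable_mx_entry.
exact: (measurableT_comp (measurable_mx_entry i j) (measurable_mx_mul A)).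
Qed.

Lemma measurable_mx_gram p q :
  measurable_fun setT (fun z : 'M[R]_(p, q) => (\tr (z *m z^T) : R)).
Proof.
have := @measurable_mx_quad p q 1%:M.
by under eq_fun do rewrite mulmx1.
Qed.

Lemma measurable_row p q (i : 'I_p) :
  measurable_fun setT (fun z : 'M[R]_(p, q) => row i z).
Proof.
apply: measurable_fun_mx => k l; under eq_fun do rewrite mxE.
exact: measurable_mx_entry.
Qed.

Lemma measurable_row_of_tuple n :
  measurable_fun setT (fun t : n.-tuple (measurableTypeR R) => \row_(j < n) (tnth t j : R)).
Proof.
apply: measurable_fun_mx => i j; under eq_fun do rewrite mxE.
exact: measurable_tnth.
Qed.

End measurable_matrices.

Section gaussian_rows.
Context {R : realType}.
Local Notation N01 := (normal_prob (0 : R) 1).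

Local Notation N01p := (N01 : probability (measurableTypeR R) R).

Definition gauss_row n : probability 'rV[R]_n R :=
  image_prob (tuple_prob (fun=> N01p)) (@measurable_row_of_tuple R n).

Lemma standard_gaussian_gauss_row n : standard_gaussian (gauss_row n).
Proof.
move=> B mB; rewrite -(tuple_prob_rect (fun=> N01p)) //.
rewrite image_probE; congr (tuple_prob _ _).
by apply/seteqP; split => t /= h j; have := h j; rewrite mxE.
Qed.

Lemma measurable_row_cons n :
  measurable_fun setT (fun xz : R * 'rV[R]_n => row_mx xz.1%:M xz.2 : 'rV[R]_(1 + n)).
Proof.
apply: measurable_fun_mx => i j; case: (split_ordP j) => k ->.
  under eq_fun do rewrite row_mxEl !mxE !ord1 eqxx mulr1n.
  exact: measurable_fst.
under eq_fun do rewrite row_mxEr.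
exact: (measurableT_comp (measurable_mx_entry i k) measurable_snd).
Qed.

Lemma ge0_integral_gauss_row n (f : 'rV[R]_(1 + n) -> \bar R) :
  measurable_fun [set: 'rV[R]_(1 + n)] f -> (forall z, 0 <= f z)%E ->
  (\int[gauss_row (1 + n)]_z f z =
   \int[N01]_x \int[gauss_row n]_z f (row_mx x%:M z))%E.
Proof.
move=> mf f0; rewrite [LHS]ge0_integral_image_prob//.
have mfr := measurableT_comp mf (@measurable_row_of_tuple R n.+1).
rewrite (ge0_integral_tuple_prob (fun=> N01p) mfr); last by move=> t; exact: f0.
apply: eq_integral => x _; rewrite [RHS]ge0_integral_image_prob//; last first.
  exact: (measurableT_comp (measurableT_comp mf (@measurable_row_cons n))
    (pair1_measurable x)).
apply: eq_integral => t _; congr f; apply/rowP => j; rewrite mxE.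
case: (split_ordP j) => k ->.
  rewrite row_mxEl mxE !ord1 eqxx mulr1n.
  by rewrite (_ : lshift n 0 = ord0)//; exact: val_inj.
rewrite row_mxEr mxE -[RHS](tnthS x).
by congr tnth; exact: val_inj.
Qed.

Lemma mxtrace_row_mx_gram m n (x : 'rV[R]_m) (z : 'rV[R]_n) :
  \tr (row_mx x z *m (row_mx x z)^T) = \tr (x *m x^T) + \tr (z *m z^T).
Proof. by rewrite tr_row_mx mul_row_col mxtraceD. Qed.

(** Induction on the triangular matrix, with the scalar change of variables on the first coordinate.
    Once that coordinate is fixed at x, the first column of A shifts the others by x c^T; the
    general translation [b] lets the induction absorb this shift. *)
Lemma ge0_integral_gauss_row_affine n (A : 'M[R]_n) : is_trig_mx A ->
  (forall i, 0 < A i i) -> forall (b : 'rV[R]_n) (f : 'rV[R]_n -> \bar R),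
  measurable_fun [set: 'rV[R]_n] f -> (forall z, 0 <= f z)%E ->
  (\int[gauss_row n]_z f z = (\det A)%:E * \int[gauss_row n]_z
    (f (z *m A^T + b)%R * (expR ((\tr (z *m z^T)
      - \tr ((z *m A^T + b) *m (z *m A^T + b)^T)) / 2))%:E))%E.
Proof.
move: n A; apply: trigsqmx_ind => [|n x0 c A tA IH] dA b f mf f0.
  rewrite det_mx00 mul1e; apply: eq_integral => z _.
  rewrite !(thinmx0 (z *m _ + b)) (thinmx0 z) subrr mul0r expR0.
  by rewrite mule1; congr f; exact: thinmx0.
pose r := x0 0 0.
have x0E : x0 = r%:M by rewrite [LHS]mx11_scalar.
have r0 : 0 < r.
  by have := dA (lshift n 0); rewrite block_mxEul.
have {}dA i : 0 < A i i.
  by have := dA (rshift 1 i); rewrite block_mxEdr.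
have dA0 : 0 <= \det A.
  by rewrite det_trig// prodr_ge0// => i _; exact: ltW.
rewrite det_lblock x0E det_scalar1 EFinM -muleA.
pose b0 := b 0 (lshift n 0); pose b' : 'rV_n := rsubmx b.
have bE : b = row_mx b0%:M b'.
  rewrite -[LHS]hsubmxK [lsubmx b]mx11_scalar; congr (row_mx _%:M _).
  by rewrite mxE.
pose sh x : 'rV[R]_n := x *: c^T + b'.
have affE x z : row_mx x%:M z *m (block_mx r%:M 0 c A)^T + b
    = row_mx (r * x + b0)%:M (z *m A^T + sh x).
  rewrite bE tr_block_mx mul_row_block add_row_mx trmx0 mulmx0 addr0.
  rewrite tr_scalar_mx -scalar_mxM -raddfD/= mulrC mul_scalar_mx /sh.
  by rewrite addrCA addrA.
rewrite ge0_integral_gauss_row//.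
pose h x := (\int[gauss_row n]_z f (row_mx x%:M z))%E.
have mfc := measurableT_comp mf (@measurable_row_cons n).
have mh : measurable_fun [set: R] h.
  apply: (measurable_fun_fubini_tonelli_F _ mfc) => xz; exact: f0.
have h0 x : (0 <= h x)%E by exact: integral_ge0.
rewrite -/h (ge0_integral_normal_affine b0 r0 mh h0); congr (_ * _)%E.
pose e2 x z := expR ((\tr (z *m z^T)
  - \tr ((z *m A^T + sh x) *m (z *m A^T + sh x)^T)) / 2).
pose F (xz : R * 'rV[R]_n) :=
  (f (row_mx (r * xz.1 + b0)%:M (xz.2 *m A^T + sh xz.1))%R * (e2 xz.1 xz.2)%:E)%E.
have msh : measurable_fun setT (fun xz : R * 'rV[R]_n => xz.2 *m A^T + sh xz.1).
  apply: measurable_fun_mx => i j.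
  rewrite (_ : (fun _ => _) = (fun w : R * 'rV[R]_n =>
      (w.2 *m A^T) i j + (w.1 * c j i + b' i j))); last first.
    apply/funext => w; rewrite mxE [sh _ i j]mxE; congr (_ + (_ + _)).
    by rewrite !mxE.
  apply: measurable_funD; last first.
    by apply: measurable_funD => //; apply: measurable_funM => //; exact: measurable_fst.
  exact: (measurableT_comp (measurable_mx_entry i j)
    (measurableT_comp (measurable_mx_mul A^T) measurable_snd)).
have mF : measurable_fun setT F.
  apply: emeasurable_funM.
    have m1 : measurable_fun setT (fun xz : R * 'rV[R]_n =>
        ((r * xz.1 + b0)%R, xz.2 *m A^T + sh xz.1)).
      apply/measurable_fun_pairP; split => //=.
      by apply: measurable_funD => //; apply: measurable_funM => //; exact: measurable_fst.
    exact: (measurableT_comp mfc m1).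
  apply/measurable_EFinP; apply: measurableT_comp => //; apply: measurable_funM => //.
  apply: measurable_funB.
    exact: (measurableT_comp (@measurable_mx_gram R 1 n) measurable_snd).
  exact: (measurableT_comp (@measurable_mx_gram R 1 n) msh).
have F0 xz : (0 <= F xz)%E by rewrite mule_ge0// lee_fin expR_ge0.
have hE x : h (r * x + b0) = ((\det A)%:E * \int[gauss_row n]_z F (x, z))%E.
  rewrite /h (IH dA (sh x))//.
  exact: (measurableT_comp mfc (pair1_measurable _)).
under eq_integral do rewrite hE -muleA.
pose I x := (\int[gauss_row n]_z F (x, z))%E.
have mI : measurable_fun [set: R] I.
  by apply: (measurable_fun_fubini_tonelli_F _ mF) => xz; exact: F0.
have I0 x : (0 <= I x)%E by exact: integral_ge0.
rewrite ge0_integralZl//; first last.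
- by move=> x _; apply: mule_ge0; [exact: I0|rewrite lee_fin expR_ge0].
- apply: emeasurable_funM => //; apply/measurable_EFinP.
  apply: measurableT_comp => //; apply: measurable_funM => //.
  apply: measurable_funB; first exact: measurable_funX.
  by apply: measurable_funX; apply: measurable_funD => //; exact: measurable_funM.
congr (_ * _)%E; rewrite ge0_integral_gauss_row; first last.
- by move=> z; rewrite mule_ge0// lee_fin expR_ge0.
- apply: emeasurable_funM; first exact: (measurableT_comp mf (measurable_mx_mulD _ _)).
  apply/measurable_EFinP; apply: measurableT_comp => //; apply: measurable_funM => //.
  apply: measurable_funB; first exact: measurable_mx_gram.
  exact: (measurableT_comp (@measurable_mx_gram R 1 _) (measurable_mx_mulD _ _)).
apply: eq_integral => x _.
have mFx := measurableT_comp mF (pair1_measurable x).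
rewrite -(@ge0_integralZr _ _ _ (gauss_row n) setT measurableT _ mFx); first last.
- by rewrite lee_fin expR_ge0.
- by move=> z _; exact: (F0 (x, z)).
apply: eq_integral => z _; rewrite affE !mxtrace_row_mx_gram /F/= -muleA -EFinM -expRD.
congr (_ * (expR _)%:E)%E; rewrite !tr_scalar_mx -!scalar_mxM !mxtrace_scalar !mulr1n.
by field.
Qed.

End gaussian_rows.

(** * Spiked Gaussian rows *)

(** Sylvester's identity, from two block triangular factorizations of one matrix. It reduces the
    determinant of a spiked covariance to that of a K by K scalar matrix. *)
Lemma det_1D_mulmxC {F : comRingType} m n (A : 'M[F]_(m, n)) (B : 'M[F]_(n, m)) :
  \det (1%:M + A *m B) = \det (1%:M + B *m A).
Proof.
have E1 : block_mx 1%:M (- B) A 1%:M =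
    block_mx 1%:M 0 A 1%:M *m block_mx 1%:M (- B) 0 (1%:M + A *m B).
  rewrite mulmx_block !mul1mx !mulmx1 !mul0mx !addr0 mulmxN addrA.
  by rewrite addrAC addNr add0r.
have E2 : block_mx 1%:M (- B) A 1%:M =
    block_mx (1%:M + B *m A) (- B) 0 1%:M *m block_mx 1%:M 0 A 1%:M.
  rewrite mulmx_block !mul1mx !mulmx1 !mul0mx !mulmx0 ?addr0 !add0r mulNmx.
  by rewrite addrK.
have := congr1 determinant E1; rewrite {1}E2 !det_mulmx !det_lblock !det_ublock.
by rewrite !det1 !mul1r !mulr1.
Qed.

(** * Second moments of Gaussian rows *)

Section gaussian_moments.
Context {R : realType}.
Local Notation N01 := (normal_prob (0 : R) 1).
Local Notation v := (@normal_moment2 R).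

Lemma integral_cst_prob {d} {T : measurableType d} (P : probability T R) (c : R) :
  (\int[P]_x c%:E = c%:E)%E.
Proof. by rewrite integral_cst// [X in (_ * X)%E](probability_setT P) mule1. Qed.

Lemma integral_normal_affine_sqr (c a : R) :
  (\int[N01]_x ((c + a * x) ^+ 2)%:E = (c ^+ 2 + v * a ^+ 2)%:E)%E.
Proof.
have int1 := @integrable_normal_id R; have int2 := @integrable_normal_sqr R.
transitivity (\int[N01]_x ((c ^+ 2)%:E
    + ((2 * c * a)%:E * x%:E + (a ^+ 2)%:E * (x ^+ 2)%:E)))%E.
  by apply: eq_integral => x _; rewrite -!EFinM -!EFinD; congr EFin; ring.
have i1 : N01.-integrable setT (fun x : R => (2 * c * a)%:E * x%:E)%E.
  exact: integrableZl.
have i2 : N01.-integrable setT (fun x : R => (a ^+ 2)%:E * (x ^+ 2)%:E)%E.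
  exact: integrableZl.
rewrite integralD//=; [|exact: finite_measure_integrable_cst|exact: integrableD].
rewrite integralD// !integralZl// integral_normal_sqr integral_normal_id.
rewrite (integral_cst_prob N01) mule0 add0e -EFinM -EFinD.
by rewrite mulrC.
Qed.

(** The constant [c] carries the coordinates already fixed in the induction. *)
Lemma integral_gauss_row_affine_sqr n (c : R) (a : 'cV[R]_n) :
  (\int[gauss_row n]_z ((c + (z *m a) 0 0) ^+ 2)%:E
   = (c ^+ 2 + v * \tr (a *m a^T))%:E)%E.
Proof.
have mq k (e : R) (b : 'cV[R]_k) :
    measurable_fun setT (fun z : 'rV[R]_k => ((e + (z *m b) 0 0) ^+ 2)%:E).
  apply/measurable_EFinP; apply: measurable_funX; apply: measurable_funD => //.
  exact: (measurableT_comp (measurable_mx_entry 0 0) (measurable_mx_mul b)).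
elim: n c a => [|n IH] c a.
  rewrite (eq_integral (cst (c ^+ 2)%:E)).
    rewrite integral_cst_prob.
    by rewrite (flatmx0 a) mul0mx mxtrace0 mulr0 addr0.
  by move=> z _; rewrite (flatmx0 a) mulmx0 mxE addr0.
pose a1 : 'cV[R]_(1 + n) := a.
pose a0 : R := a1 (lshift n 0) 0; pose a' := dsubmx a1.
have aE : a1 = col_mx a0%:M a'.
  rewrite -[LHS]vsubmxK [usubmx _]mx11_scalar; congr (col_mx _%:M _).
  by rewrite mxE.
have maff : measurable_fun setT (fun x : measurableTypeR R => c + a0 * x).
  by apply: measurable_funD => //; exact: measurable_funM.
rewrite (@ge0_integral_gauss_row R n); first last.
- by move=> z; rewrite lee_fin sqr_ge0.
- exact: mq.
transitivity (\int[N01]_x (((c + a0 * x) ^+ 2)%:E + (v * \tr (a' *m a'^T))%:E))%E.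
  apply: eq_integral => x _; rewrite -EFinD -IH; apply: eq_integral => z _.
  have -> : (row_mx x%:M z *m a) 0 0 = a0 * x + (z *m a') 0 0.
    rewrite -[LHS]/((row_mx x%:M z *m a1) 0 0) aE mul_row_col mxE -scalar_mxM mxE.
    by rewrite eqxx mulr1n mulrC.
  by rewrite addrA.
rewrite ge0_integralD//; first last.
- by move=> x _; rewrite lee_fin mulr_ge0 ?normal_moment2_ge0 ?mxtrace_gram_ge0.
- by apply/measurable_EFinP; have := measurable_funX 2 maff.
- by move=> x _; rewrite lee_fin sqr_ge0.
rewrite integral_normal_affine_sqr (integral_cst_prob N01).
rewrite -EFinD -addrA -mulrDr; congr (_ + _ * _)%:E.
rewrite -[RHS]/(\tr (a1 *m a1^T)) aE tr_col_mx mul_col_row mxtrace_block; congr (_ + _).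
by rewrite tr_scalar_mx -scalar_mxM mxtrace_scalar mulr1n expr2.
Qed.

Lemma integral_gauss_row_gram n k (B : 'M[R]_(n, k)) :
  (\int[gauss_row n]_z (\tr (z *m B *m (z *m B)^T))%:E
   = (v * \tr (B^T *m B))%:E)%E.
Proof.
transitivity (\sum_(j < k) \int[gauss_row n]_z (((0 + (z *m col j B) 0 0) ^+ 2)%:E))%E.
  rewrite -ge0_integral_sum//; first last.
  - by move=> j z _; rewrite lee_fin sqr_ge0.
  - move=> j; apply/measurable_EFinP; apply: measurable_funX; apply: measurable_funD => //.
    exact: (measurableT_comp (measurable_mx_entry 0 0) (measurable_mx_mul _)).
  apply: eq_integral => z _; rewrite sumEFin mxtrace_mul_trE big_ord1; congr EFin.
  apply: eq_bigr => j _; rewrite add0r -expr2; congr (_ ^+ 2).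
  by rewrite !mxE; apply: eq_bigr => i _; rewrite mxE.
under eq_bigr do rewrite integral_gauss_row_affine_sqr.
rewrite sumEFin -[X in \tr (_^T *m X)]trmxK mxtrace_mul_trE; congr EFin; rewrite mulr_sumr.
apply: eq_bigr => j _; rewrite expr0n add0r mxtrace_mul_trE; congr (_ * _).
by apply: eq_bigr => i _; rewrite big_ord1 !mxE.
Qed.

End gaussian_moments.

Lemma muleI_gt0 {R : realDomainType} (r : R) : 0 < r -> injective (mule r%:E).
Proof.
move=> r0 x y; case: x => [x| |]; case: y => [y| |] //;
  rewrite ?gt0_muley ?gt0_muleNy ?lte_fin// -!EFinM.
by case=> /(mulfI (lt0r_neq0 r0)) ->.
Qed.

Section spiked_rows.
Context {R : realType}.
Variables (d K : nat) (sigma : R).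
Hypothesis sigma_gt0 : 0 < sigma.
Implicit Types V : 'M[R]_(d, K).
Local Notation v := (@normal_moment2 R).
Local Notation s := (sigma / (1 + sigma)).

Lemma spiked_cov_inv V : orthonormal_columns V ->
  spiked_cov sigma V *m (1%:M - s *: (V *m V^T)) = 1%:M.
Proof.
move=> oV; have PP : V *m V^T *m (V *m V^T) = V *m V^T.
  by rewrite mulmxA -[V *m V^T *m V]mulmxA oV mulmx1.
have s1 : 1 + sigma != 0 by rewrite gt_eqF// addr_gt0.
rewrite /spiked_cov mulmxBr mulmx1 -scalemxAr mulmxDl mul1mx -scalemxAl PP.
rewrite scalerDr scalerA -scalerDl (_ : s * sigma + s = sigma); last by field.
by rewrite addrAC subrr add0r.
Qed.

Lemma spiked_cov_sym V : (spiked_cov sigma V)^T = spiked_cov sigma V.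
Proof. by rewrite linearD /= linearZ /= trmx_mul trmxK trmx1. Qed.

Lemma spiked_cov_posdef V : posdef (spiked_cov sigma V).
Proof.
move=> x x0; rewrite mulmxDr mulmx1 mulmxDl mxtraceD -scalemxAr -scalemxAl mxtraceZ.
rewrite ltr_wpDl ?mxtrace_gram_gt0//; apply: mulr_ge0; first exact: ltW.
have -> : x *m (V *m V^T) *m x^T = x *m V *m (x *m V)^T.
  by rewrite trmx_mul !mulmxA.
exact: mxtrace_gram_ge0.
Qed.

Lemma det_spiked_cov V : orthonormal_columns V ->
  \det (spiked_cov sigma V) = (1 + sigma) ^+ K.
Proof.
move=> oV; rewrite /spiked_cov addrC scalemxAl det_1D_mulmxC -scalemxAr oV.
by rewrite -[sigma *: _]/(sigma *: 1%:M) scalemx1 -raddfD/= det_scalar.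
Qed.

(** A Cholesky factor rather than the symmetric root, because the Gaussian change of variables is
    available for triangular matrices. The default 0 is never taken, by [spiked_rootP]. *)
Definition spiked_root V : 'M[R]_d := xget 0
  [set A | [/\ is_trig_mx A, forall i, 0 < A i i & A *m A^T = spiked_cov sigma V]].

Lemma spiked_rootP V : [/\ is_trig_mx (spiked_root V), forall i, 0 < spiked_root V i i &
  spiked_root V *m (spiked_root V)^T = spiked_cov sigma V].
Proof.
have exA := cholesky (spiked_cov_sym V) (@spiked_cov_posdef V).
exact: (@xgetPex _ 0 [set A : 'M[R]_d | [/\ is_trig_mx A, forall i, 0 < A i i &
  A *m A^T = spiked_cov sigma V]] exA).
Qed.

Lemma det_spiked_root_gt0 V : 0 < \det (spiked_root V).
Proof.
by have [tA dA _] := spiked_rootP V; rewrite det_trig// prodr_gt0.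
Qed.

Lemma det_spiked_root V : orthonormal_columns V ->
  \det (spiked_root V) ^+ 2 = (1 + sigma) ^+ K.
Proof.
move=> oV; have [_ _ AE] := spiked_rootP V.
by rewrite -(det_spiked_cov oV) -AE det_mulmx det_tr expr2.
Qed.

(** This cancels the normalizing constants in the likelihood ratio of two spiked laws. *)
Lemma det_spiked_root_eq V V' : orthonormal_columns V -> orthonormal_columns V' ->
  \det (spiked_root V) = \det (spiked_root V').
Proof.
move=> oV oV'; apply/eqP; rewrite -(@eqrXn2 _ 2)// ?ltW ?det_spiked_root_gt0//.
by rewrite !det_spiked_root.
Qed.

(** By [spiked_cov_inv], the left-hand side is the form of the inverse covariance at x. *)
Lemma spiked_root_gram V (z : 'rV_d) (x := z *m (spiked_root V)^T) :
  orthonormal_columns V ->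
  \tr (x *m x^T) - s * \tr (x *m V *m (x *m V)^T) = \tr (z *m z^T).
Proof.
move=> oV; have [_ _ AE] := spiked_rootP V; set A := spiked_root V in x AE *.
have uA : A \in unitmx.
  by rewrite unitmxE unitfE gt_eqF// det_spiked_root_gt0.
pose O := 1%:M - s *: (V *m V^T).
have AOA : A^T *m O *m A = 1%:M.
  have := spiked_cov_inv oV; rewrite -AE -/O => h.
  have h2 : A *m (A^T *m O *m A) = A by rewrite !mulmxA h mul1mx.
  by rewrite -[LHS](mulKmx uA) h2 mulVmx.
rewrite -mxtraceZ -mxtraceB.
have quadE (y : 'rV[R]_d) : y *m y^T - s *: (y *m V *m (y *m V)^T) = y *m O *m y^T.
  by rewrite /O mulmxBr mulmx1 mulmxBl -scalemxAr -scalemxAl trmx_mul !mulmxA.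
rewrite quadE /x trmx_mul trmxK.
by rewrite -{3}[z]mulmx1 -AOA !mulmxA.
Qed.

Definition spiked_row V : probability 'rV[R]_d R :=
  image_prob (gauss_row d) (measurable_mx_mul (p := 1) (spiked_root V)^T).

Lemma centered_gaussian_spiked_row V :
  centered_gaussian (spiked_cov sigma V) (spiked_row V).
Proof.
have [_ _ AE] := spiked_rootP V.
exists (spiked_root V), (gauss_row d); split => //.
exact: standard_gaussian_gauss_row.
Qed.

(* The log-likelihood ratio of [spiked_row V] to [spiked_row V']. *)
Definition spiked_llr V V' (x : 'rV[R]_d) : R :=
  s / 2 * (\tr (x *m V *m (x *m V)^T) - \tr (x *m V' *m (x *m V')^T)).

Lemma measurable_mul_gram V :
  measurable_fun setT (fun x : 'rV[R]_d => (\tr (x *m V *m (x *m V)^T) : R)).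
Proof.
exact: (measurableT_comp (@measurable_mx_gram R 1 K) (measurable_mx_mul V)).
Qed.

Lemma measurable_spiked_llr V V' : measurable_fun setT (spiked_llr V V').
Proof.
by apply: measurable_funM => //; apply: measurable_funB; exact: measurable_mul_gram.
Qed.

(** One integral against [gauss_row] is expanded twice by the change of variables, once with each
    root; the two determinants are equal and cancel. *)
Lemma spiked_row_density V V' : orthonormal_columns V -> orthonormal_columns V' ->
  forall f, measurable_fun [set: 'rV[R]_d] f -> (forall x, 0 <= f x)%E ->
  (\int[spiked_row V']_x f x =
   \int[spiked_row V]_x (f x * (expR (- spiked_llr V V' x))%:E))%E.
Proof.
move=> oV oV' f mf f0.
(* Up to a constant, [f] times the density of the law for [V'] relative to the standard Gaussian:
   with the root of [V'] all exponentials cancel, with that of [V] the likelihood ratio remains. *)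
pose g (x : 'rV[R]_d) := (f x *
  (expR ((\tr (x *m x^T) - (\tr (x *m x^T) - s * \tr (x *m V' *m (x *m V')^T))) / 2))%:E)%E.
have mg : measurable_fun setT g.
  apply: emeasurable_funM => //; apply/measurable_EFinP; apply: measurableT_comp => //.
  apply: measurable_funM => //; apply: measurable_funB; first exact: measurable_mx_gram.
  apply: measurable_funB; first exact: measurable_mx_gram.
  by apply: measurable_funM => //; exact: measurable_mul_gram.
have g0 x : (0 <= g x)%E by rewrite mule_ge0// lee_fin expR_ge0.
have [tA dA _] := spiked_rootP V; have [tA' dA' _] := spiked_rootP V'.
have := ge0_integral_gauss_row_affine tA' dA' 0 mg g0.
rewrite (ge0_integral_gauss_row_affine tA dA 0 mg g0) (det_spiked_root_eq oV oV').
have := @det_spiked_root_gt0 V'; move: (\det _) => D D0 /(muleI_gt0 D0) h.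
pose fl (x : 'rV[R]_d) := (f x * (expR (- spiked_llr V V' x))%:E)%E.
have mfl : measurable_fun setT fl.
  apply: emeasurable_funM; first exact: mf.
  apply/measurable_EFinP; apply: measurableT_comp; first exact: measurable_expR.
  by apply: measurableT_comp; last exact: measurable_spiked_llr.
have fl0 x : (0 <= fl x)%E by rewrite mule_ge0 ?f0// lee_fin expR_ge0.
rewrite (ge0_integral_image_prob _ _ mf f0) (ge0_integral_image_prob _ _ mfl fl0) /fl.
transitivity (\int[gauss_row d]_z (g (z *m (spiked_root V')^T + 0)%R *
  (expR ((\tr (z *m z^T) - \tr ((z *m (spiked_root V')^T + 0)
     *m (z *m (spiked_root V')^T + 0)^T)) / 2))%:E))%E.
  apply: eq_integral => z _; rewrite addr0 /g -muleA -EFinM -expRD.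
  have := @spiked_root_gram V' z oV'; cbv zeta.
  move: (z *m _) => x; set p := \tr (x *m x^T); set q := \tr (x *m V' *m _) => <-.
  by rewrite -mulrDl addrA subrK subrr mul0r expR0 mule1.
rewrite -h; clear h; apply: eq_integral => z _; rewrite addr0 /g -muleA -EFinM -expRD.
congr (_ * (expR _)%:E)%E; rewrite /spiked_llr.
have := @spiked_root_gram V z oV; cbv zeta.
move: (z *m _) => x; set p := \tr (x *m x^T); set q := \tr (x *m V *m _).
set q' := \tr (x *m V' *m _) => <-.
by field; rewrite gt_eqF// addr_gt0.
Qed.

Lemma integral_spiked_row_gram V V' :
  (\int[spiked_row V]_x (\tr (x *m V' *m (x *m V')^T))%:E
   = (v * \tr (V'^T *m spiked_cov sigma V *m V'))%:E)%E.
Proof.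
rewrite ge0_integral_image_prob; first last.
- by move=> x; rewrite lee_fin mxtrace_gram_ge0.
- by apply/measurable_EFinP; exact: measurable_mul_gram.
under eq_integral do rewrite -(mulmxA _ _ V').
rewrite integral_gauss_row_gram; have [_ _ <-] := spiked_rootP V.
by rewrite trmx_mul trmxK !mulmxA.
Qed.

Lemma integrable_spiked_row_gram V V' :
  (spiked_row V).-integrable setT (fun x => (\tr (x *m V' *m (x *m V')^T))%:E).
Proof.
apply/integrableP; split; first by apply/measurable_EFinP; exact: measurable_mul_gram.
under eq_integral do rewrite gee0_abs ?lee_fin ?mxtrace_gram_ge0//.
by rewrite integral_spiked_row_gram ltry.
Qed.

Lemma integrable_spiked_llr V V' :
  (spiked_row V).-integrable setT (fun x => (spiked_llr V V' x)%:E).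
Proof.
rewrite /spiked_llr; under eq_fun do rewrite EFinM EFinB.
apply: integrableZl => //; apply: integrableB => //; exact: integrable_spiked_row_gram.
Qed.

Lemma integral_spiked_llr V V' : orthonormal_columns V -> orthonormal_columns V' ->
  (\int[spiked_row V]_x (spiked_llr V V' x)%:E
   = (v / 2 * (sigma ^+ 2 / (1 + sigma)) *
      (K%:R - \tr (V' *m V'^T *m (V *m V^T))))%:E)%E.
Proof.
move=> oV oV'; rewrite /spiked_llr; under eq_integral do rewrite EFinM EFinB.
have iV := integrable_spiked_row_gram V V; have iV' := integrable_spiked_row_gram V V'.
rewrite integralZl//; last exact: integrableB.
rewrite integralB// !integral_spiked_row_gram -EFinB -EFinM; congr EFin.
have trE U : \tr (U^T *m spiked_cov sigma V *m U) =
    sigma * \tr (U *m U^T *m (V *m V^T)) + \tr (U^T *m U).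
  rewrite /spiked_cov mulmxDr mulmx1 mulmxDl mxtraceD -scalemxAr -scalemxAl mxtraceZ.
  by rewrite mxtrace_mulC mulmxA.
rewrite !trE oV oV' !mxtrace1.
have -> : V *m V^T *m (V *m V^T) = V *m V^T.
  by rewrite mulmxA -[V *m V^T *m V]mulmxA oV mulmx1.
rewrite [\tr (V *m V^T)]mxtrace_mulC oV mxtrace1.
by field; rewrite gt_eqF// addr_gt0.
Qed.

End spiked_rows.

(** * Two-point testing *)

Section two_points.
Context {d} {T : measurableType d} {R : realType}.
Variables (P P' : probability T R) (l : T -> R) (kappa : R).
Hypotheses (ml : measurable_fun setT l) (kappa0 : 0 <= kappa).
Hypothesis P'E : forall f, measurable_fun [set: T] f -> (forall x, 0 <= f x)%E ->
  (\int[P']_x f x = \int[P]_x (f x * (expR (- l x))%:E))%E.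
Hypothesis il : P.-integrable setT (EFin \o l).
Hypothesis El : (\int[P]_x (l x)%:E <= kappa%:E)%E.

(* [l + exp(-l)] is nonnegative, dominates [l], and has mean at most
   [kappa + 1], so Markov's inequality bounds the upper tail of [l]. *)
Lemma two_point_testing A : measurable A ->
  ((expR (- (2 * (kappa + 1))) / 2)%:E <= P A + P' (~` A))%E.
Proof.
(* Twice the bound on the mean of [h], so that Markov's inequality gives [B] probability at most
   1/2. *)
move=> mA; set lam := 2 * (kappa + 1).
have lam0 : 0 < lam by rewrite /lam mulr_gt0// ltr_wpDl.
have mexp : measurable_fun setT (fun x => expR (- l x)).
  by apply: measurableT_comp => //; exact: measurableT_comp.
pose h x := l x + expR (- l x).
have mh : measurable_fun setT h by exact: measurable_funD.
have h0 x : 0 <= h x by rewrite /h; have := expR_ge1Dx (- l x); lra.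
have Eexp : (\int[P]_x (expR (- l x))%:E = 1)%E.
  transitivity (\int[P']_x (cst 1%E x))%E; last first.
    by rewrite integral_cst// mul1e; exact: probability_setT.
  by rewrite P'E//; apply: eq_integral => x _; rewrite mul1e.
have iexp : P.-integrable setT (fun x => (expR (- l x))%:E).
  apply/integrableP; split; first exact/measurable_EFinP.
  under eq_integral do rewrite gee0_abs ?lee_fin ?expR_ge0//.
  by rewrite Eexp ltry.
have Eh : (\int[P]_x (h x)%:E <= (kappa + 1)%:E)%E.
  under eq_integral do rewrite EFinD.
  by rewrite integralD// Eexp EFinD leeD2r.
pose B := [set x | lam <= h x].
have mB : measurable B.
  rewrite (_ : B = h @^-1` `[lam, +oo[).
    by rewrite -[X in measurable X]setTI; exact: mh.
  by apply/seteqP; split => x /=; rewrite in_itv/= andbT.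
have PB : (lam%:E * P B <= (kappa + 1)%:E)%E.
  apply: le_trans Eh; rewrite -integral_cst//.
  apply: (@le_trans _ _ (\int[P]_(x in B) (h x)%:E)%E).
    apply: ge0_le_integral => //.
    - by move=> x _; rewrite lee_fin ltW.
    - exact/measurable_EFinP/measurable_funTS.
  apply: ge0_subset_integral => //; first exact/measurable_EFinP.
  by move=> x _; rewrite lee_fin.
(* Off [B] one has l <= h < lam, so P' has density at least exp(-lam) with respect to P there. As A,
   B and C cover the space, P A + P C is at least 1/2. *)
pose C := ~` A `\` B.
have mC : measurable C by apply: measurableD => //; exact: measurableC.
have PC : ((expR (- lam))%:E * P C <= P' C)%E.
  have -> : P' C = (\int[P]_(x in C) (expR (- l x))%:E)%E.
    transitivity (\int[P']_x (\1_C x)%:E)%E; first by rewrite integral_indic// setIT.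
    rewrite P'E; last 2 first.
    - exact/measurable_EFinP/measurable_indic.
    - by move=> x; rewrite lee_fin.
    rewrite [RHS]integral_mkcond; apply: eq_integral => x _; rewrite patchE indicE.
    by case: ifPn => _; rewrite ?mul1e// mul0e.
  rewrite -integral_cst//; apply: ge0_le_integral => //.
  - by move=> x _; rewrite lee_fin expR_ge0.
  - exact/measurable_EFinP/measurable_funTS.
  - move=> x [_ /negP]; rewrite lee_fin ler_expR lerN2 -ltNge => hx.
    by apply/ltW; apply: le_lt_trans hx; rewrite lerDl expR_ge0.
have P1 : (1 <= P A + P B + P C)%E.
  rewrite -(probability_setT P).
  apply: (@le_trans _ _ (P (A `|` B `|` C))).
    apply: le_measure; rewrite ?inE//; first by do 2 apply: measurableU => //.
    move=> x _; have [xA|xA] := pselect (A x); first by left; left.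
    by have [xB|xB] := pselect (B x); [left; right|right].
  apply: le_trans (measureU2 _ _ _) _ => //; first exact: measurableU.
  by rewrite leeD2r// measureU2.
have CA : (P' C <= P' (~` A))%E.
  apply: le_measure; rewrite ?inE//; first exact: measurableC.
  exact: subDsetl.
apply: (le_trans _ (leeD2l _ CA)).
have fP E : measurable E -> P E = (fine (P E))%:E.
  by move=> mE; rewrite fineK// fin_num_measure.
have fP' : P' C = (fine (P' C))%:E by rewrite fineK// fin_num_measure.
have e1 : expR (- lam) <= 1 by rewrite -expR0 ler_expR oppr_le0 ltW.
have e0 := expR_ge0 (- lam).
have a0 : 0 <= fine (P A) by exact: fine_ge0.
move: PB PC P1; rewrite fP' (fP A)// (fP B)// (fP C)// -!EFinM -!EFinD !lee_fin.
move: (fine (P A)) (fine (P B)) (fine (P C)) (fine (P' C)) a0 => a b c c' a0.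
rewrite /lam in lam0 *; move: (expR _) e0 e1 => e e0 e1 hb hc h1.
have b2 : b <= 1 / 2 by nra.
have : e * a <= a by rewrite ler_piMl.
have : e * (1 / 2) <= e * (a + c) by apply: ler_wpM2l => //; lra.
by rewrite mulrDr; lra.
Qed.

End two_points.

(** * The law of the data *)

Section spiked_data.
Context {R : realType}.
Variables (m n d K : nat) (sigma : R).
Hypothesis sigma_gt0 : 0 < sigma.
Implicit Types (V : 'M[R]_(d, K)) (Vs : 'I_m -> 'M[R]_(d, K)).
Local Notation v := (@normal_moment2 R).

Definition mx_of_rows (t : n.-tuple 'rV[R]_d) : 'M[R]_(n, d) :=
  \matrix_(i, j) tnth t i 0 j.

Lemma row_mx_of_rows t i : row i (mx_of_rows t) = tnth t i.
Proof. by apply/rowP => j; rewrite !mxE. Qed.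

Lemma measurable_mx_of_rows : measurable_fun setT mx_of_rows.
Proof.
apply: measurable_fun_mx => i j; under eq_fun do rewrite mxE.
exact: (measurableT_comp (measurable_mx_entry 0 j) (measurable_tnth i)).
Qed.

Definition spiked_mat V : probability 'M[R]_(n, d) R :=
  image_prob (tuple_prob (fun=> spiked_row sigma V)) measurable_mx_of_rows.

Definition spiked_data Vs : probability (data R m n d) R :=
  tuple_prob (fun i => spiked_mat (Vs i)).

Lemma spiked_mat_rect V (B : 'I_n -> set 'rV[R]_d) : (forall j, measurable (B j)) ->
  spiked_mat V [set M | forall j, B j (row j M)] = (\prod_(j < n) spiked_row sigma V (B j))%E.
Proof.
move=> mB; rewrite -tuple_prob_rect// image_probE; congr (tuple_prob _ _).
by apply/seteqP; split => t /= h j; have := h j; rewrite row_mx_of_rows.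
Qed.

Lemma measurable_obs (i : 'I_m) : measurable_fun setT (@obs R m n d i).
Proof. exact: measurable_tnth. Qed.

Lemma spiked_data_obs Vs i A : measurable A ->
  spiked_data Vs (@obs R m n d i @^-1` A) = spiked_mat (Vs i) A.
Proof. exact: tuple_prob_tnth. Qed.

Lemma measurable_mx_rect (B : 'I_n -> set 'rV[R]_d) : (forall j, measurable (B j)) ->
  measurable [set M : 'M[R]_(n, d) | forall j, B j (row j M)].
Proof.
move=> mB.
rewrite (_ : [set _ | _] = [set M | forall j, j \in [set: 'I_n]%SET -> B j (row j M)]).
  by apply: measurable_rect => // j; exact: measurable_row.
by apply/seteqP; split => M /= h j => [_|]; apply: h; rewrite finset.inE.
Qed.

Lemma spiked_data_row Vs i j A : measurable A ->
  spiked_data Vs [set X | A (row j (obs i X))] = spiked_row sigma (Vs i) A.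
Proof.
move=> mA; pose B k := if k == j then A else setT.
rewrite -[LHS]/(spiked_data Vs (@obs R m n d i @^-1` [set M | A (row j M)])).
rewrite (_ : [set M | A (row j M)] = [set M | forall k, B k (row k M)]); last first.
  apply/seteqP; split => M /= h; last by have := h j; rewrite /B eqxx.
  by move=> k; rewrite /B; case: eqP => // ->.
have mB k : measurable (B k) by rewrite /B; case: ifP.
rewrite spiked_data_obs; last exact: measurable_mx_rect.
rewrite spiked_mat_rect// (bigD1 j)//= /B eqxx big1 ?mule1// => k /negbTE ->.
exact: probability_setT.
Qed.

Lemma spiked_data_rows_iid Vs i :
  rows_iid_gaussian (spiked_data Vs) i (spiked_cov sigma (Vs i)).
Proof.
split=> [B mB|j].
  transitivity (spiked_data Vs (@obs R m n d i @^-1`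
      [set M | forall j, B j (row j M)])).
    congr (spiked_data Vs _); apply/seteqP; split => X /= h j => [|_]; apply: h.
    by rewrite finset.inE.
  rewrite spiked_data_obs; last exact: measurable_mx_rect.
  rewrite spiked_mat_rect//; apply: eq_big => [j|j _]; first by rewrite finset.inE.
  exact/esym/spiked_data_row.
have [A [nu [AE snu nuE]]] := centered_gaussian_spiked_row sigma_gt0 (Vs i).
exists A, nu; split => // B mB; rewrite -nuE// -(spiked_data_row Vs i j mB).
by [].
Qed.

Lemma spiked_data_independent Vs :
  mutually_independent (spiked_data Vs) [set: 'I_m]%SET (@obs R m n d).
Proof.
move=> B mB; transitivity (spiked_data Vs [set X | forall i, B i (tnth X i)]).
  congr (spiked_data Vs _); apply/seteqP; split => X /= h j => [|_]; apply: h.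
  by rewrite finset.inE.
rewrite [LHS]tuple_prob_rect//; apply: eq_big => [j|j _]; first by rewrite finset.inE.
by rewrite spiked_data_obs.
Qed.

Lemma spiked_data_in_model (delta epsilon : R) Vs (S : {set 'I_m}) :
  (forall i, orthonormal_columns (Vs i)) ->
  #|~: S|%:R <= epsilon * m%:R ->
  (forall i j, i \in S -> j \in S ->
    frobenius_norm (Vs i *m (Vs i)^T - Vs j *m (Vs j)^T) <= delta) ->
  in_model delta epsilon sigma (spiked_data Vs) Vs.
Proof.
move=> oV cS closeS; split => //; exists S.
have ind := spiked_data_independent Vs.
split => //; split => //.
- exact: mutually_independentS.
- by move=> i _; exact: spiked_data_rows_iid.
- apply: independent_familiesP => //; first exact: measurable_obs.
  by rewrite disjoint_sym finset.disjoints_subset finset.setCK.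
- exact: mutually_independentS.
- by move=> i _; exact: spiked_data_rows_iid.
Qed.

Definition spiked_data_llr Vs Vs' (X : data R m n d) : R :=
  \sum_(i < m) \sum_(j < n) spiked_llr sigma (Vs i) (Vs' i) (row j (obs i X)).

Lemma measurable_spiked_data_llr Vs Vs' : measurable_fun setT (spiked_data_llr Vs Vs').
Proof.
apply: measurable_sum => i; apply: measurable_sum => j.
exact: (measurableT_comp (measurable_spiked_llr _ _ _)
  (measurableT_comp (measurable_row j) (measurable_obs i))).
Qed.

Lemma spiked_mat_density V V' : orthonormal_columns V -> orthonormal_columns V' ->
  forall f, measurable_fun [set: 'M[R]_(n, d)] f -> (forall x, 0 <= f x)%E ->
  (\int[spiked_mat V']_x f x = \int[spiked_mat V]_x
     (f x * (expR (- \sum_(j < n) spiked_llr sigma V V' (row j x)))%:E))%E.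
Proof.
move=> oV oV' f mf f0.
have ml : measurable_fun setT
    (fun x : 'M[R]_(n, d) => \sum_(j < n) spiked_llr sigma V V' (row j x)).
  apply: measurable_sum => j.
  exact: (measurableT_comp (measurable_spiked_llr _ _ _) (measurable_row j)).
have me : measurable_fun setT (fun x => expR (- spiked_llr sigma V V' x)).
  apply: measurableT_comp => //; apply: measurableT_comp => //.
  exact: measurable_spiked_llr.
pose fl (x : 'M[R]_(n, d)) :=
  (f x * (expR (- \sum_(j < n) spiked_llr sigma V V' (row j x)))%:E)%E.
have mfl : measurable_fun setT fl.
  apply: emeasurable_funM; first exact: mf.
  by apply/measurable_EFinP; apply: measurableT_comp => //; exact: measurableT_comp.
have fl0 x : (0 <= fl x)%E by rewrite mule_ge0 ?f0// lee_fin expR_ge0.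
rewrite (ge0_integral_image_prob _ _ mf f0) (ge0_integral_image_prob _ _ mfl fl0) /fl.
rewrite (tuple_prob_density (mu := fun=> spiked_row sigma V)
  (g := fun _ x => expR (- spiked_llr sigma V V' x))); first last.
- by move=> t; exact: f0.
- exact: (measurableT_comp mf measurable_mx_of_rows).
- by move=> _ g mg g0; exact: spiked_row_density.
- by move=> _ x; exact: expR_ge0.
- by [].
apply: eq_integral => t _; congr (_ * _%:E)%E.
rewrite -sumrN expR_sum; apply: eq_bigr => j _; by rewrite row_mx_of_rows.
Qed.

Lemma spiked_data_density Vs Vs' :
  (forall i, orthonormal_columns (Vs i)) -> (forall i, orthonormal_columns (Vs' i)) ->
  forall f, measurable_fun [set: data R m n d] f -> (forall X, 0 <= f X)%E ->
  (\int[spiked_data Vs']_X f X =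
   \int[spiked_data Vs]_X (f X * (expR (- spiked_data_llr Vs Vs' X))%:E))%E.
Proof.
move=> oV oV' f mf f0.
rewrite /spiked_data (tuple_prob_density (mu := fun i => spiked_mat (Vs i))
  (g := fun i x => expR (- \sum_(j < n) spiked_llr sigma (Vs i) (Vs' i) (row j x)))
  _ _ _ mf f0).
- by apply: eq_integral => X _; congr (_ * _%:E)%E; rewrite -sumrN expR_sum.
- move=> i; apply: measurableT_comp; first exact: measurable_expR.
  apply: measurableT_comp; first exact: oppr_measurable.
  apply: measurable_sum => j.
  exact: (measurableT_comp (measurable_spiked_llr _ _ _) (measurable_row j)).
- by move=> i x; exact: expR_ge0.
- by move=> i g mg g0; exact: spiked_mat_density.
Qed.

Lemma integral_spiked_data_row Vs i j (g : 'rV[R]_d -> \bar R) :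
  (spiked_row sigma (Vs i)).-integrable setT g ->
  (spiked_data Vs).-integrable setT (fun X => g (row j (obs i X))) /\
  (\int[spiked_data Vs]_X g (row j (obs i X)) = \int[spiked_row sigma (Vs i)]_x g x)%E.
Proof.
move=> ig; have mg := measurable_int _ ig.
pose Q := image_prob (spiked_data Vs)
  (measurableT_comp (@measurable_row R n d j) (measurable_obs i)).
have QE A : measurable A -> spiked_row sigma (Vs i) A = Q A.
  by move=> mA; rewrite -(spiked_data_row Vs i j).
have iQ : Q.-integrable setT g.
  apply/integrableP; split => //; move/integrableP: ig => [_].
  by rewrite (eq_measure_integral Q)// => A mA _; exact: QE.
have [h1 h2] := integral_image_prob
  (mf := measurableT_comp (@measurable_row R n d j) (measurable_obs i)) iQ.
split => //; by rewrite [LHS]h2; apply: eq_measure_integral => A mA AT; exact/esym/QE.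
Qed.

(** Additivity of the divergence is linearity of the integral here: each summand depends on one row,
    whose marginal law is known. *)
Lemma integral_spiked_data_llr Vs Vs' :
  (forall i, orthonormal_columns (Vs i)) -> (forall i, orthonormal_columns (Vs' i)) ->
  (spiked_data Vs).-integrable setT (EFin \o spiked_data_llr Vs Vs') /\
  (\int[spiked_data Vs]_X (spiked_data_llr Vs Vs' X)%:E =
   (v / 2 * (sigma ^+ 2 / (1 + sigma)) * n%:R *
     \sum_(i < m) (K%:R - \tr (Vs' i *m (Vs' i)^T *m (Vs i *m (Vs i)^T))))%:E)%E.
Proof.
move=> oV oV'.
have irow i j := @integral_spiked_data_row Vs i j _
  (integrable_spiked_llr sigma_gt0 (Vs i) (Vs' i)).
have i1 i : (spiked_data Vs).-integrable setT (fun X => \sum_(j < n)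
    (spiked_llr sigma (Vs i) (Vs' i) (row j (obs i X)))%:E)%E.
  by apply: integrable_sum => // j _; exact: (irow i j).1.
have llrE X : (spiked_data_llr Vs Vs' X)%:E = (\sum_(i < m) \sum_(j < n)
    (spiked_llr sigma (Vs i) (Vs' i) (row j (obs i X)))%:E)%E.
  by rewrite -sumEFin; apply: eq_bigr => i _; rewrite sumEFin.
split.
  apply: (eq_integrable measurableT (fun X => \sum_(i < m) \sum_(j < n)
    (spiked_llr sigma (Vs i) (Vs' i) (row j (obs i X)))%:E)%E).
    by move=> X _; rewrite /= llrE.
  exact: integrable_sum.
under eq_integral do rewrite llrE.
rewrite integral_sum//.
rewrite -[_ * n%:R * _]mulrA mulr_sumr mulr_sumr -sumEFin; apply: eq_bigr => i _.
rewrite integral_sum//; last by move=> j; exact: (irow i j).1.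
under eq_bigr do rewrite (irow _ _).2 (integral_spiked_llr sigma_gt0)//.
by rewrite sumEFin sumr_const card_ord -mulr_natl; congr EFin; ring.
Qed.

End spiked_data.

(** * Assouad's argument *)

Section many_events.
Context {d} {T : measurableType d} {R : realType} {E : finType}.
Variables (P : probability T R) (Q : {set E}) (A : E -> set T) (c : R).
Hypotheses (mA : forall e, measurable (A e)) (Q0 : (0 < #|Q|)%N) (c0 : 0 <= c).
Hypothesis sumA : 2 * c * #|Q|%:R <= \sum_(e in Q) fine (P (A e)).

Definition nb_events (x : T) : R := \sum_(e in Q) \1_(A e) x.

Lemma measurable_nb_events : measurable_fun setT nb_events.
Proof.
rewrite (_ : nb_events = fun x => \sum_(e <- enum Q) \1_(A e) x).
  by apply: measurable_sum => e; exact: measurable_indic.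
by apply/funext => x; rewrite big_enum.
Qed.

Lemma measurable_many_events : measurable [set x | c * #|Q|%:R <= nb_events x].
Proof.
rewrite (_ : [set _ | _] = nb_events @^-1` `[c * #|Q|%:R, +oo[).
  by rewrite -[X in measurable X]setTI; exact: measurable_nb_events.
by apply/seteqP; split => x /=; rewrite in_itv/= andbT.
Qed.

(** A reverse Markov inequality: the count is at most |Q| on the event and less than c |Q| off it,
    so a mean of 2 c |Q| forces probability c. *)
Lemma many_events_prob : (c%:E <= P [set x | (c * #|Q|%:R <= nb_events x)%R])%E.
Proof.
set G := [set x | _]; have mG : measurable G := measurable_many_events.
have Q0' : 0 < #|Q|%:R :> R by rewrite ltr0n.
have nb0 x : 0 <= nb_events x by apply: sumr_ge0.
have nbQ x : nb_events x <= #|Q|%:R.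
  rewrite -sum1_card natr_sum; apply: ler_sum => e _.
  by rewrite indicE; case: (_ \in _).
have EN : (\int[P]_x (nb_events x)%:E = (\sum_(e in Q) fine (P (A e)))%:E)%E.
  rewrite /nb_events -big_enum; under eq_integral do rewrite -big_enum -sumEFin.
  rewrite ge0_integral_sum//.
  - rewrite -sumEFin; apply: eq_bigr => e _.
    by rewrite integral_indic// setIT fineK// fin_num_measure.
  - by move=> e; exact/measurable_EFinP/measurable_indic.
have : (\int[P]_x (nb_events x)%:E <=
    (c * #|Q|%:R)%:E + (#|Q|%:R)%:E * P G)%E.
  have -> : P G = (\int[P]_x (\1_G x)%:E)%E by rewrite integral_indic// setIT.
  have mG1 : measurable_fun setT (fun x => (\1_G x)%:E : \bar R).
    exact/measurable_EFinP/measurable_indic.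
  have mG2 : measurable_fun setT (fun x => (#|Q|%:R * \1_G x)%:E : \bar R).
    exact/measurable_EFinP/measurable_funM.
  have -> : ((#|Q|%:R)%:E * \int[P]_x (\1_G x)%:E =
      \int[P]_x (#|Q|%:R * \1_G x)%:E)%E.
    under [RHS]eq_integral do rewrite EFinM.
    by rewrite ge0_integralZl// => x _; rewrite lee_fin.
  rewrite -(integral_cst_prob P) -ge0_integralD//; last first.
  - by move=> x _; rewrite lee_fin mulr_ge0.
  apply: ge0_le_integral => //.
  - by move=> x _; rewrite lee_fin.
  - exact/measurable_EFinP/measurable_nb_events.
  - exact: emeasurable_funD.
  move=> x _; rewrite -EFinD lee_fin indicE.
  have [xG|xG] := boolP (x \in G).
    by rewrite mulr1 (le_trans (nbQ x))// lerDr mulr_ge0.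
  rewrite mulr0 addr0 ltW// ltNge; apply/negP => h; move: xG => /negP; apply.
  by rewrite inE.
have PGE : P G = (fine (P G))%:E by rewrite fineK// fin_num_measure.
rewrite EN PGE -EFinM -EFinD !lee_fin => h.
have {}h := le_trans sumA h.
rewrite -(ler_pM2r Q0'); lra.
Qed.

End many_events.

(** * The cube of sign matrices *)

Section hypercube.
Context {R : realType}.

Lemma sqr_frobenius_norm p q (A : 'M[R]_(p, q)) :
  frobenius_norm A ^+ 2 = \sum_i \sum_j A i j ^+ 2.
Proof.
by rewrite sqr_sqrtr// sumr_ge0// => i _; rewrite sumr_ge0// => j _; exact: sqr_ge0.
Qed.

Lemma sqr_frobenius_normE p q (A : 'M[R]_(p, q)) :
  frobenius_norm A ^+ 2 = \tr (A *m A^T).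
Proof.
rewrite sqr_frobenius_norm mxtrace_mul_trE.
by apply: eq_bigr => i _; apply: eq_bigr => j _; rewrite expr2.
Qed.

Lemma frobenius_norm_ge0 p q (A : 'M[R]_(p, q)) : 0 <= frobenius_norm A.
Proof. exact: sqrtr_ge0. Qed.

Variables (K p : nat).
Implicit Types W : 'M[R]_(p, K).

Definition graph_basis W : 'M[R]_(K + p, K) := xget 0
  [set V | V^T *m V = 1%:M /\ V *m V^T = graph_proj W].

Lemma graph_basisP W : (graph_basis W)^T *m graph_basis W = 1%:M /\
  graph_basis W *m (graph_basis W)^T = graph_proj W.
Proof.
have [V V1 V2] := graph_frame W.
apply: (@xgetPex _ 0 [set V : 'M[R]_(K + p, K) |
  V^T *m V = 1%:M /\ V *m V^T = graph_proj W]).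
by exists V.
Qed.

(** For two projectors P, P' of trace K the squared distance is 2 (K - \tr (P' P)). *)
Lemma sqr_frobenius_graph_proj_le W W' :
  frobenius_norm (graph_proj W - graph_proj W') ^+ 2 <=
  2 * \tr ((W - W') *m (W - W')^T).
Proof.
rewrite sqr_frobenius_normE linearB /= !graph_proj_sym mulmxBl !mulmxBr.
rewrite !graph_proj_idem !mxtraceB !mxtrace_graph_proj.
rewrite (mxtrace_mulC (graph_proj W)).
by have := mxtrace_graph_proj_ge W W'; lra.
Qed.

Variables (m : nat) (t : R).
Local Notation bits := {ffun 'I_m * 'I_p * 'I_K -> bool}.

Definition bits_mx (w : bits) (a : 'I_m) : 'M[R]_(p, K) :=
  \matrix_(j, k) (if w (a, j, k) then t else - t).

Definition flip (e : 'I_m * 'I_p * 'I_K) (w : bits) : bits :=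
  [ffun x => (x == e) (+) w x].

Lemma flipK e : involutive (flip e).
Proof. by move=> w; apply/ffunP => x; rewrite !ffunE addbA addbb. Qed.

Lemma bits_mx_flip w a j k :
  bits_mx (flip (a, j, k) w) a = bits_mx w a - (2 * bits_mx w a j k) *: delta_mx j k.
Proof.
apply/matrixP => j' k'; rewrite !mxE ffunE !xpair_eqE eqxx /=.
have [->|_] := eqVneq j' j; have [->|_] := eqVneq k' k; rewrite /= ?mulr0 ?subr0//.
by case: (w _); rewrite /= mulr1; ring.
Qed.

Lemma bits_mx_flip_neq w e a : e.1.1 != a -> bits_mx (flip e w) a = bits_mx w a.
Proof.
case: e => [[b j] k] /= ba; apply/matrixP => j' k'; rewrite !mxE ffunE !xpair_eqE.
by rewrite eq_sym (negbTE ba).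
Qed.

Hypothesis t0 : 0 <= t.

Lemma norm_bits_mx w a j k : `|bits_mx w a j k| = t.
Proof. by rewrite mxE; case: ifP; rewrite ?normrN ger0_norm. Qed.

Lemma mxtrace_bits_mxB_le w a b (D := bits_mx w a - bits_mx w b) :
  \tr (D *m D^T) <= 4 * t ^+ 2 * (p * K)%:R.
Proof.
rewrite mxtrace_mul_trE; apply: (@le_trans _ _ (\sum_(j < p) \sum_(k < K) 4 * t ^+ 2)).
  apply: ler_sum => j _; apply: ler_sum => k _; rewrite !mxE.
  by case: ifP => _; case: ifP => _; have := sqr_ge0 t; nra.
by rewrite !sumr_const !card_ord -mulrnA mulnC mulr_natr.
Qed.

Lemma mxtrace_flip w a j k (D := bits_mx w a - bits_mx (flip (a, j, k) w) a) :
  \tr (D *m D^T) = 4 * t ^+ 2.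
Proof.
rewrite /D bits_mx_flip subKr [_^T]linearZ /= trmx_delta.
rewrite -scalemxAl -scalemxAr mul_delta_mx !mxtraceZ.
have -> : \tr (delta_mx j j : 'M[R]_p) = 1.
  by rewrite /mxtrace (bigD1 j)//= big1 ?mxE ?eqxx ?addr0// => i /negbTE ij; rewrite mxE ij.
rewrite mulr1 -expr2 exprMn -[bits_mx w a j k ^+ 2]real_normK ?num_real//.
by rewrite norm_bits_mx; ring.
Qed.

End hypercube.

(** * Missed entries and the loss on the cube *)

Section assouad.
Context {R : realType}.
Variables (m n p K : nat) (sigma t : R) (h : 'I_m -> 'I_m).
Hypotheses (sigma_gt0 : 0 < sigma) (t0 : 0 <= t) (m0 : (0 < m)%N).
Local Notation d := (K + p)%N.
Local Notation bits := {ffun 'I_m * 'I_p * 'I_K -> bool}.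
Local Notation v := (@normal_moment2 R).

(** The bound of [two_point_testing] for a log-likelihood ratio of mean at most 2 v, the value
    reached in [cube_llr_mean_le]. *)
Definition testing_bound : R := expR (- (2 * (2 * v + 1))) / 2.
Local Notation kappa := testing_bound.

(** [h i] is the block of signs read by sample i: a constant [h] shares one matrix among all
    samples, the identity gives each sample its own. *)
Definition cube_frame (w : bits) (i : 'I_m) : 'M[R]_(d, K) :=
  graph_basis (bits_mx t w (h i)).

Definition cube_law (w : bits) : probability (data R m n d) R :=
  spiked_data n sigma (cube_frame w).

Lemma cube_frame_orthonormal w i : orthonormal_columns (cube_frame w i).
Proof. exact: (graph_basisP _).1. Qed.

Lemma cube_frame_proj w i :
  cube_frame w i *m (cube_frame w i)^T = graph_proj (bits_mx t w (h i)).
Proof. exact: (graph_basisP _).2. Qed.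

(** Two sign matrices are at squared distance at most 4 t^2 p K, and their projectors at most twice
    that; samples with a common block have equal projectors. *)
Lemma cube_in_model (delta epsilon : R) (S : {set 'I_m}) w : 0 <= delta ->
  #|~: S|%:R <= epsilon * m%:R ->
  (forall i j, i \in S -> j \in S ->
    h i = h j \/ 8 * t ^+ 2 * (p * K)%:R <= delta ^+ 2) ->
  model m n d K delta epsilon sigma (cube_law w, cube_frame w).
Proof.
move=> d0 cS hS.
apply: (@spiked_data_in_model R m n d K sigma sigma_gt0 delta epsilon _ S) => //.
  by move=> i; exact: cube_frame_orthonormal.
move=> i j iS jS; rewrite -(@ler_pXn2r _ 2) ?nnegrE ?frobenius_norm_ge0//.
rewrite !cube_frame_proj; have [->|ht] := hS i j iS jS.
  by rewrite subrr sqr_frobenius_normE mul0mx mxtrace0 sqr_ge0.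
apply: le_trans ht; apply: le_trans (sqr_frobenius_graph_proj_le _ _) _.
have := mxtrace_bits_mxB_le t w (h i) (h j).
by cbv zeta; move: (\tr _) => x; lra.
Qed.

Variable Vhat : 'I_m -> data R m n d -> 'M[R]_(d, K).
Hypothesis mVhat : forall i, measurable_fun setT (Vhat i).

Definition proj_entry i j k (X : data R m n d) : R :=
  (Vhat i X *m (Vhat i X)^T) (rshift K j) (lshift p k).

Definition entry_error (w : bits) i j k (X : data R m n d) : R :=
  `|proj_entry i j k X - graph_entry (bits_mx t w (h i)) j k|.

Definition entry_missed w i j k : set (data R m n d) :=
  [set X | t / 2 <= entry_error w i j k X].

Lemma measurable_proj_mx_entry i a b :
  measurable_fun setT (fun X => ((Vhat i X *m (Vhat i X)^T) a b : R)).
Proof.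
under eq_fun do rewrite mxE; apply: measurable_sum => l.
under eq_fun do rewrite [(_^T) l b]mxE.
by apply: measurable_funM; exact: (measurableT_comp (measurable_mx_entry _ _) (mVhat i)).
Qed.

Lemma measurable_entry_missed w i j k : measurable (entry_missed w i j k).
Proof.
have me : measurable_fun setT (entry_error w i j k).
  apply: measurableT_comp => //; apply: measurable_funB => //.
  exact: measurable_proj_mx_entry.
rewrite (_ : entry_missed _ _ _ _ = entry_error w i j k @^-1` `[t / 2, +oo[).
  by rewrite -[X in measurable X]setTI; exact: me.
by apply/seteqP; split => x /=; rewrite in_itv/= andbT.
Qed.

Variable q : nat.
Hypothesis dt : d%:R * t ^+ 2 <= 8^-1.
Hypothesis qt : q%:R * n%:R * t ^+ 2 <= (sigma + 1) / sigma ^+ 2.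

(** The two true entries are at least t apart, so no estimate is within t/2 of both. *)
Lemma entry_missed_flip w i j k :
  ~` entry_missed w i j k `<=` entry_missed (flip (h i, j, k) w) i j k.
Proof.
move=> X /negP; rewrite /entry_missed /= -ltNge /entry_error bits_mx_flip.
set W := bits_mx t w (h i); set x := proj_entry i j k X.
have := @graph_entry_flip_ge R K p W t j k t0 (norm_bits_mx t0 w (h i)) dt.
set f := graph_entry W j k; set f' := graph_entry _ j k => ff' xf.
have : `|f' - f| <= `|x - f| + `|x - f'|.
  by rewrite (_ : f' - f = (x - f) - (x - f')) ?ler_normB//; ring.
lra.
Qed.

(** Only the samples reading the flipped block contribute, at most [q] of them, each with a gap of
    at most 4 t^2; [qt] is exactly what keeps the total below 2 v. *)
Lemma cube_llr_mean_le w i j k : (#|[set i' | h i' == h i]%SET| <= q)%N ->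
  (\int[cube_law w]_X (spiked_data_llr sigma (cube_frame w)
     (cube_frame (flip (h i, j, k) w)) X)%:E <= (2 * v)%:E)%E.
Proof.
move=> hq; set w' := flip _ w.
rewrite (integral_spiked_data_llr n sigma_gt0 (cube_frame_orthonormal w)
  (cube_frame_orthonormal w')).2 lee_fin.
have gapE i' : K%:R - \tr (cube_frame w' i' *m (cube_frame w' i')^T *m
    (cube_frame w i' *m (cube_frame w i')^T)) <= (if h i' == h i then 4 * t ^+ 2 else 0).
  rewrite !cube_frame_proj; apply: le_trans (mxtrace_graph_proj_ge _ _) _.
  case: eqP => [->|/eqP hi].
    by have := mxtrace_flip t0 w (h i) j k; cbv zeta => ->.
  by rewrite bits_mx_flip_neq 1?eq_sym// subrr mul0mx mxtrace0.
have v0 := @normal_moment2_ge0 R.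
have s2 : 0 < sigma ^+ 2 by rewrite exprn_gt0.
have c0 : 0 <= v / 2 * (sigma ^+ 2 / (1 + sigma)) * n%:R.
  by rewrite !mulr_ge0// ?invr_ge0 ?ltW// addr_gt0.
apply: (@le_trans _ _ (v / 2 * (sigma ^+ 2 / (1 + sigma)) * n%:R * (q%:R * (4 * t ^+ 2)))).
  apply: ler_wpM2l => //.
  apply: (@le_trans _ _ (\sum_i' if h i' == h i then 4 * t ^+ 2 else 0)).
    by apply: ler_sum => i' _; exact: gapE.
  rewrite -big_mkcond/= sumr_const -[leLHS]mulr_natl ler_wpM2r ?mulr_ge0 ?sqr_ge0// ler_nat.
  by apply: leq_trans hq; apply/eq_leq/eq_card => i'; rewrite !inE.
have -> : v / 2 * (sigma ^+ 2 / (1 + sigma)) * n%:R * (q%:R * (4 * t ^+ 2)) =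
    2 * v * (sigma ^+ 2 / (1 + sigma)) * (q%:R * n%:R * t ^+ 2).
  by field; rewrite gt_eqF// addr_gt0.
apply: (@le_trans _ _ (2 * v * (sigma ^+ 2 / (1 + sigma)) * ((sigma + 1) / sigma ^+ 2))).
  by apply: ler_wpM2l => //; rewrite !mulr_ge0// ?invr_ge0 ?ltW// addr_gt0.
rewrite le_eqVlt; apply/orP; left; apply/eqP; field.
by rewrite !gt_eqF// addr_gt0.
Qed.

Lemma entry_missed_pair w i j k : (#|[set i' | h i' == h i]%SET| <= q)%N ->
  kappa <= fine (cube_law w (entry_missed w i j k)) +
    fine (cube_law (flip (h i, j, k) w) (entry_missed (flip (h i, j, k) w) i j k)).
Proof.
move=> hq; set w' := flip _ w.
have mA := measurable_entry_missed w i j k; have mA' := measurable_entry_missed w' i j k.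
have := two_point_testing (P := cube_law w) (P' := cube_law w')
  (l := spiked_data_llr sigma (cube_frame w) (cube_frame w')) (kappa := 2 * v)
  (measurable_spiked_data_llr _ _ _) _ _ _ (cube_llr_mean_le w j k hq) mA.
have i1 : 0 <= 2 * v by rewrite mulr_ge0// normal_moment2_ge0.
move=> /(_ i1); have i2 := spiked_data_density sigma_gt0 (cube_frame_orthonormal w)
  (cube_frame_orthonormal w').
move=> /(_ (i2 n)) /(_ (integral_spiked_data_llr n sigma_gt0 (cube_frame_orthonormal w)
  (cube_frame_orthonormal w')).1) tp.
rewrite -lee_fin EFinD !fineK ?fin_num_measure//; apply: le_trans tp _.
apply: leeD2l; apply: le_measure; rewrite ?inE//; first exact: measurableC.
exact: entry_missed_flip.
Qed.

(** Flipping a bit permutes the cube, so summing the inequality for pairs counts every law twice. *)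
Lemma entry_missed_sum i j k : (#|[set i' | h i' == h i]%SET| <= q)%N ->
  kappa / 2 * #|{: bits}|%:R <= \sum_(w : bits) fine (cube_law w (entry_missed w i j k)).
Proof.
move=> hq; set F := fun w : bits => fine (cube_law w (entry_missed w i j k)).
have FE : \sum_w F w = \sum_w F (flip (h i, j, k) w).
  by rewrite (reindex_inj (inv_inj (flipK (h i, j, k)))).
have : \sum_(w : bits) kappa <= \sum_w (F w + F (flip (h i, j, k) w)).
  by apply: ler_sum => w _; exact: entry_missed_pair.
rewrite big_split/= -FE sumr_const -mulr_natr; lra.
Qed.

Variable B : {set 'I_m}.
Hypothesis Bq : forall i, i \in B -> (#|[set i' | h i' == h i]%SET| <= q)%N.
Hypotheses (B0 : (0 < #|B|)%N) (p0 : (0 < p)%N) (K0 : (0 < K)%N).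

Lemma testing_bound_gt0 : 0 < kappa.
Proof. by rewrite divr_gt0// expR_gt0. Qed.

(** Indexed by samples, not by blocks: a bit in a shared block counts once for every sample of [B]
    that reads it, as it does in the loss. *)
Let Q : {set 'I_m * 'I_p * 'I_K} := [set e | e.1.1 \in B]%SET.

Let cardQ : #|Q| = (#|B| * (p * K))%N.
Proof.
have -> : Q = finset.setX (finset.setX B [set: 'I_p]%SET) [set: 'I_K]%SET.
  by apply/setP => -[[i j] k]; rewrite !inE /= !andbT.
by rewrite !cardsX !cardsT !card_ord mulnA.
Qed.

Lemma exists_hard_bits : exists w : bits,
  kappa / 2 * #|Q|%:R <= \sum_(e in Q) fine (cube_law w (entry_missed w e.1.1 e.1.2 e.2)).
Proof.
apply/not_existsP => H.
have : \sum_(w : bits) \sum_(e in Q) fine (cube_law w (entry_missed w e.1.1 e.1.2 e.2))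
    < \sum_(w : bits) kappa / 2 * #|Q|%:R.
  apply: ltr_sum => [|w _]; last by rewrite ltNge; apply/negP; exact: H.
  by apply/hasP; exists [ffun=> false]; rewrite ?mem_index_enum.
apply/negP; rewrite -leNgt exchange_big /= sumr_const.
apply: (@le_trans _ _ (\sum_(e in Q) kappa / 2 * #|{: bits}|%:R)).
  by rewrite sumr_const -[leLHS]mulr_natr -[leRHS]mulr_natr mulrAC.
by apply: ler_sum => e; rewrite inE => eB; apply: entry_missed_sum; exact: Bq.
Qed.

(** Only the samples in [B] and the lower-left block are kept, and each missed entry there costs at
    least (t/2)^2. *)
Lemma average_loss_ge w X :
  m%:R^-1 * (t ^+ 2 / 4) * nb_events Q (fun e => entry_missed w e.1.1 e.1.2 e.2) X
  <= average_loss (fun i => Vhat i X) (cube_frame w).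
Proof.
rewrite /average_loss -mulrA; apply: ler_wpM2l; first by rewrite invr_ge0.
rewrite /nb_events mulr_sumr.
have -> : \sum_(e in Q) t ^+ 2 / 4 * \1_(entry_missed w e.1.1 e.1.2 e.2) X =
    \sum_(i in B) \sum_j \sum_k t ^+ 2 / 4 * \1_(entry_missed w i j k) X.
  rewrite pair_big /= pair_big /=; apply: eq_bigl => -[[i j] k].
  by rewrite inE /= !andbT.
rewrite [leRHS](bigID (mem B)) /= ler_wpDr ?sumr_ge0//.
  by move=> i _; rewrite sqr_ge0.
apply: ler_sum => i _; rewrite sqr_frobenius_norm big_split_ord /= ler_wpDl//.
  by rewrite sumr_ge0// => a _; rewrite sumr_ge0// => b _; exact: sqr_ge0.
apply: ler_sum => j _; rewrite big_split_ord /= ler_wpDr//.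
  by rewrite sumr_ge0// => b _; exact: sqr_ge0.
apply: ler_sum => k _; rewrite indicE; case: (boolP (X \in _)) => [|_]; last first.
  by rewrite mulr0 sqr_ge0.
rewrite inE mulr1 /entry_missed /= /entry_error /proj_entry => hX.
have -> : (Vhat i X *m (Vhat i X)^T - cube_frame w i *m (cube_frame w i)^T)
    (rshift K j) (lshift p k) = (Vhat i X *m (Vhat i X)^T) (rshift K j) (lshift p k)
    - graph_entry (bits_mx t w (h i)) j k.
  by rewrite cube_frame_proj -graph_projE !mxE.
rewrite -[leRHS]real_normK ?num_real//.
have -> : t ^+ 2 / 4 = (t / 2) ^+ 2 by field.
by rewrite ler_pXn2r// nnegrE divr_ge0.
Qed.

Lemma measurable_average_loss w :
  measurable_fun setT (fun X => average_loss (fun i => Vhat i X) (cube_frame w)).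
Proof.
apply: measurable_funM => //; apply: measurable_sum => i.
under eq_fun do rewrite sqr_frobenius_norm.
apply: measurable_sum => a; apply: measurable_sum => b; apply: measurable_funX.
under eq_fun do rewrite mxE; apply: measurable_funD => //.
exact: measurable_proj_mx_entry.
Qed.

(** [kappa / 16] is the fraction [kappa / 4] of missed entries times the factor 1/4 in the cost t^2
    / 4 of each. *)
Lemma assouad_cube (thr : R) :
  thr <= kappa / 16 * t ^+ 2 * (#|B| * (p * K))%:R / m%:R ->
  exists w, ((kappa / 4)%:E <= cube_law w
    [set X | (thr <= average_loss (fun i => Vhat i X) (cube_frame w))%R])%E.
Proof.
move=> thr_le; have [w hw] := exists_hard_bits; exists w.
have Q0 : (0 < #|Q|)%N by rewrite cardQ !muln_gt0 B0 p0.
have k0 := ltW testing_bound_gt0.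
have mA (e : 'I_m * 'I_p * 'I_K) : measurable (entry_missed w e.1.1 e.1.2 e.2).
  exact: measurable_entry_missed.
have := @many_events_prob _ _ R _ (cube_law w) Q _ (kappa / 4) mA Q0.
have -> : 2 * (kappa / 4) = kappa / 2 by field.
move=> /(_ _ hw) hG; apply: (le_trans (hG _)); first by rewrite divr_ge0.
apply: le_measure; rewrite ?inE.
- exact: measurable_many_events.
- rewrite (_ : [set _ | _] = (fun X => average_loss (fun i => Vhat i X) (cube_frame w))
      @^-1` `[thr, +oo[).
    by rewrite -[X in measurable X]setTI; exact: measurable_average_loss.
  by apply/seteqP; split => x /=; rewrite in_itv/= andbT.
move=> X /= hX; apply: (le_trans thr_le); apply: le_trans (average_loss_ge w X).
rewrite cardQ in hX.
have c0 : 0 <= m%:R^-1 * (t ^+ 2 / 4) by rewrite mulr_ge0 ?invr_ge0 ?divr_ge0 ?sqr_ge0.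
apply: le_trans (ler_wpM2l c0 hX).
by rewrite le_eqVlt; apply/orP; left; apply/eqP; field; rewrite pnatr_eq0 -lt0n.
Qed.

End assouad.

(** * The three regimes *)

Section hard_instances.
Context {R : realType}.
Variables (m n p K : nat) (delta epsilon sigma : R).
Hypotheses (m0 : (0 < m)%N) (n0 : (0 < n)%N) (K0 : (0 < K)%N) (Kp : (K <= p)%N).
Hypotheses (delta0 : 0 <= delta) (sigma0 : 0 < sigma) (eps0 : 0 <= epsilon).
Local Notation d := (K + p)%N.
Local Notation tau := ((sigma + 1) / sigma ^+ 2).
Hypothesis tau_le : tau * (d%:R / n%:R) <= 8^-1.
Variable Vhat : 'I_m -> data R m n d -> 'M[R]_(d, K).
Hypothesis mVhat : forall i, measurable_fun setT (Vhat i).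
Local Notation kappa := (@testing_bound R).

Let tau0 : 0 < tau.
Proof. by rewrite divr_gt0 ?exprn_gt0// addr_gt0. Qed.

Let tau_ge0 : 0 <= tau := ltW tau0.

Let p0 : (0 < p)%N := leq_trans K0 Kp.

Definition hard_instance (thr : R) := exists2 PV : probability (data R m n d) R *
    ('I_m -> 'M[R]_(d, K)), model m n d K delta epsilon sigma PV &
  ((kappa / 4)%:E <= PV.1 [set X | (thr <= average_loss (fun i => Vhat i X) PV.2)%R])%E.

(** [x] is the squared entry size t^2. The condition x <= tau / n, combined with [tau_le], gives d
    t^2 <= 1/8. *)
Lemma hard_instance_cube (x : R) (h : 'I_m -> 'I_m) (q : nat) (B S : {set 'I_m}) thr :
  0 <= x -> x <= tau / n%:R -> q%:R * n%:R * x <= tau ->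
  #|~: S|%:R <= epsilon * m%:R ->
  (forall i j, i \in S -> j \in S ->
    h i = h j \/ 8 * x * (p * K)%:R <= delta ^+ 2) ->
  (0 < #|B|)%N ->
  (forall i, i \in B -> (#|[set i' | h i' == h i]%SET| <= q)%N) ->
  thr <= kappa / 16 * x * (#|B| * (p * K))%:R / m%:R ->
  hard_instance thr.
Proof.
move=> x0 xn qx cS hS B0 Bq hthr.
have xE : Num.sqrt x ^+ 2 = x by rewrite sqr_sqrtr.
have t0 : 0 <= Num.sqrt x by exact: sqrtr_ge0.
have dt : d%:R * Num.sqrt x ^+ 2 <= 8^-1.
  rewrite xE; apply: le_trans tau_le; apply: le_trans (ler_wpM2l _ xn) _ => //.
  by rewrite mulrCA.
have [||w hw] := @assouad_cube R m n p K sigma (Num.sqrt x) h sigma0 t0 m0 Vhat mVhat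
  q dt _ B Bq B0 p0 K0 thr; [by rewrite xE|by rewrite xE|].
exists (cube_law n sigma (Num.sqrt x) h w, cube_frame (Num.sqrt x) h w) => //.
apply: (@cube_in_model R m n p K sigma (Num.sqrt x) h sigma0 delta epsilon S w) => //.
by rewrite xE.
Qed.

Lemma natr_pK_ge : (d * K)%:R <= 2 * (p * K)%:R :> R.
Proof. by rewrite -natrM ler_nat mulnA leq_mul2r mul2n -addnn leq_add2r Kp orbT. Qed.

Let kappa0 : 0 < kappa := @testing_bound_gt0 R.

(** All samples read one block, so their projectors coincide whatever delta is, and [q = m] costs a
    factor m in [x]. The constant is 32 = 16 * 2, with the 2 from [natr_pK_ge]. *)
Lemma hard_instance_shared thr :
  thr <= kappa / 32 * (tau * (d * K)%:R / n%:R / m%:R) -> hard_instance thr.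
Proof.
move=> hthr.
have m0' : 0 < m%:R :> R by rewrite ltr0n.
have n0' : 0 < n%:R :> R by rewrite ltr0n.
apply: (@hard_instance_cube (tau / n%:R / m%:R) (fun=> Ordinal m0) m [set: 'I_m]%SET
  [set: 'I_m]%SET).
- by apply: divr_ge0 => //; apply: divr_ge0.
- rewrite ler_pdivrMr// ler_peMr ?ler1n//; exact: divr_ge0.
- by rewrite le_eqVlt; apply/orP; left; apply/eqP; field; rewrite !gt_eqF.
- by rewrite finset.setCT cards0 mulr_ge0.
- by move=> i j _ _; left.
- by rewrite cardsT card_ord.
- by move=> i _; rewrite (leq_trans (max_card _))// card_ord.
- apply: (le_trans hthr); rewrite cardsT card_ord [(m * _)%:R]natrM.
  have -> : kappa / 16 * (tau / n%:R / m%:R) * (m%:R * (p * K)%:R) / m%:R =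
      kappa / 32 * (tau / n%:R / m%:R) * (2 * (p * K)%:R).
    by field; rewrite !gt_eqF.
  have -> : kappa / 32 * (tau * (d * K)%:R / n%:R / m%:R) =
      kappa / 32 * (tau / n%:R / m%:R) * (d * K)%:R by field; rewrite !gt_eqF.
  apply: ler_wpM2l; last exact: natr_pK_ge.
  apply: mulr_ge0; first by rewrite divr_ge0// ltW.
  by apply: divr_ge0 => //; apply: divr_ge0.
Qed.

(** Every sample has its own block, and [x] is the minimum divided by 8 d K: its bound by delta^2
    gives closeness of the projectors, its other bound keeps x below tau / n. The constant is 256 =
    16 * 8 * 2. *)
Lemma hard_instance_spread thr :
  thr <= kappa / 256 * Num.min (delta ^+ 2) (tau * (d * K)%:R / n%:R) ->
  hard_instance thr.
Proof.
have m0' : 0 < m%:R :> R by rewrite ltr0n.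
have n0' : 0 < n%:R :> R by rewrite ltr0n.
have dK0 : 0 < (d * K)%:R :> R by rewrite ltr0n muln_gt0 K0 addn_gt0 K0.
have pKd : (p * K)%:R <= (d * K)%:R :> R by rewrite ler_nat leq_mul2r leq_addl orbT.
have := natr_pK_ge; move: ((d * K)%:R) dK0 pKd => D D0 pKd Dp hthr.
pose y := Num.min (delta ^+ 2) (tau * D / n%:R).
have y0 : 0 <= y.
  rewrite le_min sqr_ge0 /=; apply: divr_ge0 => //.
  by apply: mulr_ge0 => //; exact: ltW.
have yd : y <= delta ^+ 2 by rewrite ge_min lexx.
have yt : y <= tau * D / n%:R by rewrite ge_min lexx orbT.
have x0 : 0 <= y / (8 * D) by rewrite divr_ge0// mulr_ge0// ltW.
have xt : y / (8 * D) <= tau / n%:R.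
  rewrite ler_pdivrMr ?mulr_gt0//; apply: (le_trans yt).
  rewrite (_ : tau / n%:R * (8 * D) = 8 * (tau * D / n%:R)); last by ring.
  rewrite ler_peMl ?ler1n//; apply: divr_ge0 => //.
  by apply: mulr_ge0 => //; exact: ltW.
apply: (@hard_instance_cube (y / (8 * D)) id 1 [set: 'I_m]%SET [set: 'I_m]%SET) => //.
- by rewrite mul1r mulrC -ler_pdivlMr.
- by rewrite finset.setCT cards0 mulr_ge0.
- move=> i j _ _; right; apply: le_trans yd.
  rewrite (_ : 8 * _ * _ = y * ((p * K)%:R / D)); last by field; rewrite gt_eqF.
  by rewrite ler_piMr// ler_pdivrMr// mul1r.
- by rewrite cardsT card_ord.
- move=> i _; rewrite (_ : [set _ | _]%SET = [set i]%SET) ?cards1//.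
  by apply/setP => j; rewrite !inE.
- apply: (le_trans hthr); rewrite cardsT card_ord [(m * _)%:R]natrM -/y.
  have -> : kappa / 16 * (y / (8 * D)) * (m%:R * (p * K)%:R) / m%:R =
      kappa / 256 * (y / D) * (2 * (p * K)%:R).
    by field; rewrite !gt_eqF.
  have -> : kappa / 256 * y = kappa / 256 * (y / D) * D.
    by field; rewrite gt_eqF.
  apply: ler_wpM2l; last exact: Dp.
  apply: mulr_ge0; first by rewrite divr_ge0// ltW.
  by apply: divr_ge0 => //; exact: ltW.
Qed.

(** The first f = floor(epsilon m) samples are corrupted, each with its own block, while all others
    read the block of the last index [i0], which is not corrupted because f < m. From f >= 1 one
    gets epsilon m <= 2 f, hence 64 = 16 * 2 * 2. *)
Lemma hard_instance_corrupt thr : epsilon <= 2^-1 -> 1 <= epsilon * m%:R ->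
  thr <= kappa / 64 * (epsilon * (tau * (d * K)%:R / n%:R)) ->
  hard_instance thr.
Proof.
move=> eps2 em hthr.
have m0' : 0 < m%:R :> R by rewrite ltr0n.
have n0' : 0 < n%:R :> R by rewrite ltr0n.
have em0 : 0 <= epsilon * m%:R by rewrite mulr_ge0.
pose f := Num.truncn (epsilon * m%:R).
have /andP[fle ltf] := truncn_itv em0; rewrite -/f in fle ltf.
have f0 : (0 < f)%N.
  by rewrite lt0n; apply/eqP => fz; rewrite fz in ltf; lra.
have fm : (f < m)%N.
  rewrite -(ltr_nat R); apply: (le_lt_trans fle).
  by rewrite gtr_pMl//; lra.
have i0m : (m.-1 < m)%N by rewrite ltn_predL.
pose i0 : 'I_m := Ordinal i0m.
pose B := [set i : 'I_m | (i < f)%N]%SET.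
have cB : #|B| = f.
  rewrite -sum1_card (eq_bigl (fun i : 'I_m => (i < f)%N)) => [|i]; last by rewrite inE.
  by rewrite (big_ord_narrow (ltnW fm)) sum1_card card_ord.
have i0B : i0 \notin B by rewrite inE -leqNgt -ltnS prednK.
apply: (@hard_instance_cube (tau / n%:R) (fun i => if i \in B then i else i0) 1
  B (~: B)%SET) => //.
- exact: divr_ge0.
- by rewrite mul1r mulrC divfK// gt_eqF.
- by rewrite finset.setCK cB.
- by move=> i j; rewrite !finset.in_setC => /negbTE -> /negbTE ->; left.
- by rewrite cB.
- move=> i iB; rewrite iB (_ : [set _ | _]%SET = [set i]%SET) ?cards1//.
  apply/setP => j; rewrite !inE; case: ifPn => // jB.
  apply/eqP/eqP => [E|E]; first by move: i0B; rewrite E iB.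
  by move: jB; rewrite E -(finset.in_set (fun i : 'I_m => (i < f)%N)) iB.
- apply: (le_trans hthr); rewrite cB [(f * _)%:R]natrM.
  have -> : kappa / 16 * (tau / n%:R) * (f%:R * (p * K)%:R) / m%:R =
      kappa / 64 * (tau / n%:R / m%:R) * ((2 * f%:R) * (2 * (p * K)%:R)).
    by field; rewrite !gt_eqF.
  have -> : kappa / 64 * (epsilon * (tau * (d * K)%:R / n%:R)) =
      kappa / 64 * (tau / n%:R / m%:R) * ((epsilon * m%:R) * (d * K)%:R).
    by field; rewrite !gt_eqF.
  apply: ler_wpM2l.
    apply: mulr_ge0; first by rewrite divr_ge0// ltW.
    by apply: divr_ge0 => //; apply: divr_ge0.
  apply: ler_pM => //; last exact: natr_pK_ge.
  have : 1 <= f%:R :> R by rewrite ler1n.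
  by move: ltf; rewrite -natr1; lra.
Qed.

End hard_instances.

Theorem theorem4p3 (R : realType) :
  exists C1 C2 C5 C6 : R,
    [/\ 0 < C1, 0 < C2, 0 < C5 & 0 < C6] /\
    forall (m n d K : nat) (delta epsilon sigma : R),
      (0 < m)%N -> (0 < n)%N -> (0 < d)%N -> (0 < K)%N ->
      0 <= delta -> 0 < sigma -> 0 <= epsilon <= 2^-1 ->
      K%:R <= d%:R / C1 ->
      (sigma + 1) / sigma ^+ 2 * (d%:R / n%:R) <= C2 ->
      (C6%:E <=
       ereal_inf
         [set ereal_sup
           [set PV.1 [set X : data R m n d |
              (C5 * ((sigma + 1) * K%:R * d%:R / (sigma ^+ 2 * n%:R * m%:R)
                     + Num.min (delta ^+ 2)
                         ((sigma + 1) * K%:R * d%:R / (sigma ^+ 2 * n%:R))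
                     + (sigma + 1) * epsilon * K%:R * d%:R
                         / (sigma ^+ 2 * n%:R))
               <= average_loss (fun i => Vhat i X) PV.2)%R]
           | PV in model m n d K delta epsilon sigma]
         | Vhat in estimators R m n d K])%E.
Proof.
have k0 := @testing_bound_gt0 R; set k := testing_bound in k0.
have pos j : 0 < j.+1%:R :> R by rewrite ltr0n.
(* 768 = 3 * 256: the sum of the three terms is at most three times the largest, and 256 is the
   worst constant of the three constructions. *)
exists 2, 8^-1, (k / 768), (k / 4); split.
  split; [exact: pos|by rewrite invr_gt0; exact: pos| |]; apply: divr_gt0 k0 _; exact: pos.
move=> m n d K delta epsilon sigma m0 n0 d0 K0 delta0 sigma0 /andP[eps0 eps2] Kd tau_le.
have [p dE] : exists p, d = (K + p)%N.
  exists (d - K)%N; rewrite subnKC//; rewrite ler_pdivlMr// in Kd.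
  rewrite -(ler_nat R); apply: le_trans Kd; rewrite ler_peMr// ler1n//.
subst d.
have Kp : (K <= p)%N.
  move: Kd; rewrite ler_pdivlMr// -natrM ler_nat muln2 -addnn leq_add2l.
  exact.
apply/ereal_infP => _ [Vhat mVhat <-].
have mV i : measurable_fun setT (Vhat i) by have [] := mVhat i.
set thr := k / 768 * _.
suff [PV inm hPV] : hard_instance delta epsilon sigma Vhat thr.
  by apply: (le_trans hPV); apply: ereal_sup_ubound; exists PV.
have m0' : 0 < m%:R :> R by rewrite ltr0n.
have n0' : 0 < n%:R :> R by rewrite ltr0n.
have s0' : sigma != 0 by rewrite gt_eqF.
pose r0 := (sigma + 1) / sigma ^+ 2 * ((K + p) * K)%:R / n%:R.
have r0_ge0 : 0 <= r0.
  by rewrite /r0 divr_ge0// mulr_ge0// divr_ge0 ?sqr_ge0// addr_ge0// ltW.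
have thrE : thr = k / 768 * (r0 / m%:R + Num.min (delta ^+ 2) r0 + epsilon * r0).
  rewrite /thr /r0; congr (_ * (_ + Num.min _ _ + _)); rewrite [((K + p) * K)%:R]natrM; field;
  by rewrite ?s0' ?gt_eqF.
have M1 : 0 <= r0 / m%:R by rewrite divr_ge0.
have M2 : 0 <= Num.min (delta ^+ 2) r0 by rewrite le_min sqr_ge0.
have M3 : 0 <= epsilon * r0 by rewrite mulr_ge0.
have [h1|h1] := leP (epsilon * r0) (r0 / m%:R).
  have [h2|h2] := leP (Num.min (delta ^+ 2) r0) (r0 / m%:R).
    apply: hard_instance_shared => //; rewrite -/r0 thrE -/k.
    nra.
  apply: hard_instance_spread => //; rewrite -/r0 thrE -/k.
  nra.
have [h2|h2] := leP (Num.min (delta ^+ 2) r0) (epsilon * r0); last first.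
  apply: hard_instance_spread => //; rewrite -/r0 thrE -/k.
  nra.
(* Here the corruption term exceeds the shared one, r0 / m < epsilon r0, which forces epsilon m > 1:
   at least one sample may be corrupted. *)
apply: hard_instance_corrupt => //; last by rewrite -/r0 thrE -/k; nra.
rewrite ltr_pdivrMr// in h1.
have r0_gt0 : 0 < r0.
  by rewrite lt0r r0_ge0 andbT; apply/eqP => r00; move: h1; rewrite r00 mulr0 mul0r ltxx.
by rewrite -(ler_pM2l r0_gt0) mulr1 mulrCA mulrA ltW.
Qed.
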